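(* Let $\{J_\omega\}_{\omega\in\Omega}$ be a family of ergodic Jacobi operators with parameters $\{a_n(\omega),b_n(\omega)\}_n$, let $\Sigma$ be its (almost sure) spectrum, and let $L$ be its Lyapunov exponent. Then for $\mu$-a.e. $\omega$, $$|\Sigma|\le 4A\exp\Big(\sup_{E\in\Sigma}|L(E)|\Big),$$ where $A:=\lim_{n\to\infty}(a_1(\omega)\cdots a_n(\omega))^{1/n}$ and $|K|$ denotes the Lebesgue measure of the set $K$.
   Context: Setting. $(\Omega,\mu)$ is a probability measure space and $T:\Omega\to\Omega$ is an ergodic (measure-preserving) transformation. $f,g:\Omega\to\mathbb{R}$ are measurable functions, with $f$ positive, bounded and invertible (i.e. $1/f$ bounded), and $g$ bounded. For $\omega\in\Omega$ and $n\in\mathbb{N}=\{1,2,\dots\}$ put $a_n(\omega)=f(T^n\omega)$ and $b_n(\omega)=g(T^n\omega)$. The Jacobi operator $J_\omega$ is the self-adjoint operator on $\ell^2(\mathbb{N})$ given by $$(J_\omega\psi)_n=a_{n-1}(\omega)\psi_{n-1}+b_n(\omega)\psi_n+a_n(\omega)\psi_{n+1},\qquad n\in\mathbb{N},$$ with the convention $a_0=0$. The family $\{J_\omega\}_{\omega\in\Omega}$ is called an ergodic family of Jacobi operators with parameters $\{a_n(\omega),b_n(\omega)\}_n$. Spectrum. $\Sigma\subset\mathbb{R}$ denotes the compact set, independent of $\omega$, such that $\sigma(J_\omega)=\Sigma$ for $\mu$-a.e. $\omega$; it is called the spectrum of $J_\omega$. Lyapunov exponent. For $z\in\mathbb{C}$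 set $$A_z(\omega)=\frac{1}{f(T\omega)}\begin{pmatrix} z-g(T\omega) & -f(\omega)\\ f(T\omega) & 0\end{pmatrix},\qquad A_z^n(\omega)=A_z(T^{n-1}\omega)\cdots A_z(T\omega)A_z(\omega),\quad n\ge1.$$ These are the transfer matrices: solutions of $a_{n-1}(\omega)\psi_{n-1}+b_n(\omega)\psi_n+a_n(\omega)\psi_{n+1}=z\psi_n$, $n\ge1$, with $a_0=0$, satisfy $(\psi_{n+1},\psi_n)^{T}=A_z^n(\omega)(\psi_1,\psi_0)^{T}$ with $\psi_0=0$. The Lyapunov exponent $L(z)\in[0,\infty)$ is the number satisfying, for $\mu$-a.e. $\omega$, $$L(z)=\inf_{n\ge1}\frac1n\int_\Omega\log\|A_z^n\|\,d\mu=\lim_{n\to\infty}\frac1n\int_\Omega\log\|A_z^n\|\,d\mu=\lim_{n\to\infty}\frac1n\log\|A_z^n(\omega)\|.$$ *)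

(* Defs.v *)
From mathcomp Require Import all_boot all_order all_algebra.
From mathcomp Require Import complex.
From mathcomp Require Import all_classical all_reals all_analysis.

Set Implicit Arguments.
Unset Strict Implicit.
Unset Printing Implicit Defensive.

Import Order.TTheory GRing.Theory Num.Theory.
Import numFieldNormedType.Exports.

Local Open Scope classical_set_scope.
Local Open Scope complex_scope.
Local Open Scope ring_scope.

Section Ergodic.
Context {R : realType} {d : measure_display} {Omega : measurableType d}.

Definition measure_preserving (mu : probability Omega R) (T : Omega -> Omega) :=
  measurable_fun [set: Omega] T /\
  (forall B, measurable B -> mu (T @^-1` B) = mu B).

Definition ergodic (mu : probability Omega R) (T : Omega -> Omega) :=
  measure_preserving mu T /\
  (forall B, measurable B -> T @^-1` B = B -> mu B = 0%E \/ mu B = 1%E).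

End Ergodic.

(* Sequences indexed by {1, 2, ...} are stored as functions psi : nat -> R[i]
   where psi k stands for the entry of index k.+1. *)
Section Spectrum.
Context {R : realType}.
Implicit Types (psi : nat -> R[i]) (H B : (nat -> R[i]) -> nat -> R[i]).

Definition ell2 : set (nat -> R[i]) :=
  [set psi | cvgn (series (fun k => Normc.normc (psi k) ^+ 2))].

Definition ell2_norm psi : R :=
  Num.sqrt (limn (series (fun k => Normc.normc (psi k) ^+ 2))).

Definition bounded_on_ell2 B :=
  (forall psi, ell2 psi -> ell2 (B psi)) /\
  (exists M : R, forall psi, ell2 psi -> ell2_norm (B psi) <= M * ell2_norm psi).

Definition shifted_op H (z : R[i]) psi : nat -> R[i] :=
  fun k => H psi k - z * psi k.

(* Linearity of the inverse B on ell2 is automatic when H is linear. *)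
Definition resolvent_set H : set R[i] :=
  [set z | exists B, bounded_on_ell2 B /\
     (forall psi, ell2 psi ->
        shifted_op H z (B psi) = psi /\ B (shifted_op H z psi) = psi)].

Definition spectrum H : set R[i] := ~` resolvent_set H.

(* At k = 0 the junk value psi k.-1 is multiplied by a 0, which is 0 below. *)
Definition jacobi (a b : nat -> R) psi : nat -> R[i] :=
  fun k => (a k)%:C * psi k.-1 + (b k.+1)%:C * psi k + (a k.+1)%:C * psi k.+1.

End Spectrum.

Section ErgodicJacobi.
Context {R : realType} {d : measure_display} {Omega : measurableType d}.
Variables (mu : probability Omega R) (T : Omega -> Omega) (f g : Omega -> R).

Definition coef_a (w : Omega) (n : nat) : R :=
  if n == 0%N then 0 else f (iter n T w).

Definition coef_b (w : Omega) (n : nat) : R := g (iter n T w).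

Definition ergodic_jacobi (w : Omega) : (nat -> R[i]) -> nat -> R[i] :=
  jacobi (coef_a w) (coef_b w).

Definition transfer (z : R[i]) (w : Omega) : 'M[R[i]]_2 :=
  ((f (T w))^-1)%:C *:
  \matrix_(i < 2, j < 2)
    (nth [::] [:: [:: z - (g (T w))%:C; - (f w)%:C];
                  [:: (f (T w))%:C    ; 0         ]] i)`_j.

Fixpoint cocycle (z : R[i]) (n : nat) (w : Omega) : 'M[R[i]]_2 :=
  if n is m.+1 then transfer z (iter m T w) *m cocycle z m w else 1%:M.

Definition vec_norm (v : 'cV[R[i]]_2) : R :=
  Num.sqrt (\sum_(i < 2) Normc.normc (v i ord0) ^+ 2).

Definition op_norm (M : 'M[R[i]]_2) : R :=
  sup [set vec_norm (M *m v) | v in [set v | vec_norm v = 1%R]].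

Definition lyapunov (z : R[i]) : R :=
  inf [set n%:R^-1 * Rintegral mu [set: Omega] (fun w => ln (op_norm (cocycle z n w)))
      | n in [set n | (0 < n)%N]].

Definition geometric_means (w : Omega) : nat -> R :=
  fun n => (\prod_(1 <= i < n.+1) coef_a w i) `^ n%:R^-1.

End ErgodicJacobi.

(* Main.v *)
Require Import Defs.
From mathcomp Require Import all_boot all_order all_algebra.
From mathcomp Require Import complex.
From mathcomp Require Import all_classical all_reals all_analysis.
From mathcomp Require Import measurable_realfun.
From mathcomp Require Import ring lra.

Set Implicit Arguments.
Unset Strict Implicit.
Unset Printing Implicit Defensive.

Import Order.TTheory GRing.Theory Num.Theory.
Import numFieldNormedType.Exports.

Local Open Scope classical_set_scope.
Local Open Scope complex_scope.
Local Open Scope ring_scope.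

(** The upper left entry of the [n]-step transfer matrix at energy [E] is
    [P_n(E) / (a_1 ... a_n)], where [P_n] is a monic polynomial of degree [n]
    (the characteristic polynomial of the truncated Jacobi matrix).  Hence, if
    [K] is a compact set on which the Lyapunov exponent is at most [s], then
    [|P_n|] is at most about [(A exp s)^n] on [K].  A monic polynomial cannot be
    small on a large set: by Polya's inequality, a compact set of reals on which
    a monic polynomial of degree [n] is bounded by [c] has measure at most
    [4 (c/2)^(1/n)].  Letting [n] tend to infinity gives [|K| <= 4 A exp s].

    Ergodic theory supplies the two growth rates.  If [h] is bounded with
    negative mean, its Birkhoff sums are almost surely bounded above
    ([birkhoff_sum_bounded_above]); this is the upper half of the pointwise
    ergodic theorem, and applied to [log f] and [- log f], shifted by constants,
    it yields the limit of the geometric means.  Averaging over blocks carries it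
    over to subadditive sequences ([subadditive_le_linear]), so that for each
    fixed [E] and almost every [w] the norm of the [n]-step transfer matrix is at
    most [exp ((L E + e) n + M)] for all [n], with a constant [M] depending on
    [w] and [E].

    Polya's inequality needs such a bound on a whole set of energies for one
    [w].  By Fubini, for almost every [w] the bound holds for almost every [E] in
    [K], with [M] depending on [E].  For such a [w], the subsets of [K] on which a
    given [M] works are compact, increase with [M], and fill [K] up to a null set
    ([measure_le_slack]); each of them has measure at most [4 A exp (s + 2 e)].

    Polya's inequality itself is proved by interpolation
    ([polya_inequality]).  A compact set of measure [m] contains points at least
    as far apart as any prescribed points of the interval [[0, m]], and the
    leading coefficient of a polynomial of degree [n] is a combination of its
    values at [n + 1] points whose weights shrink when the points move apart.
    With the extrema of the Chebyshev polynomial as prescribed points, the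
    weights add up to the leading coefficient of that polynomial. *)

(** * Birkhoff sums *)

Section BirkhoffSums.
Context {R : realType} {d : measure_display} {Omega : measurableType d}.
Variables (mu : probability Omega R) (T : Omega -> Omega).
Implicit Types (h : Omega -> R) (w : Omega).

Lemma bounded_integrable h (B : R) :
  measurable_fun [set: Omega] h -> (forall w, `|h w| <= B) ->
  mu.-integrable [set: Omega] (EFin \o h).
Proof.
move=> mh hB; apply: measurable_bounded_integrable => //.
  by rewrite /= probability_setT ltry.
exists B; split; first by rewrite num_real.
by move=> M BM w _ /=; rewrite (le_trans (hB w))// ltW.
Qed.

Lemma le_Rintegral_probability h (B c : R) :
  measurable_fun [set: Omega] h -> (forall w, `|h w| <= B) ->
  (forall w, h w <= c) -> Rintegral mu [set: Omega] h <= c.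
Proof.
move=> mh hB hc.
have -> : c = Rintegral mu [set: Omega] (fun=> c).
  by rewrite Rintegral_cst//= probability_setT mulr1.
apply: le_Rintegral => //; first exact: (bounded_integrable mh hB).
by apply: (@bounded_integrable _ `|c|) => //; apply: measurable_cst.
Qed.

Lemma ge_Rintegral_probability h (B c : R) :
  measurable_fun [set: Omega] h -> (forall w, `|h w| <= B) ->
  (forall w, c <= h w) -> c <= Rintegral mu [set: Omega] h.
Proof.
move=> mh hB hc.
have -> : c = Rintegral mu [set: Omega] (fun=> c).
  by rewrite Rintegral_cst//= probability_setT mulr1.
apply: le_Rintegral => //; last exact: (bounded_integrable mh hB).
by apply: (@bounded_integrable _ `|c|) => //; apply: measurable_cst.
Qed.

Lemma Rintegral_measure_preserving h (B : R) :
  measure_preserving mu T ->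
  measurable_fun [set: Omega] h -> (forall w, `|h w| <= B) ->
  Rintegral mu [set: Omega] (h \o T) = Rintegral mu [set: Omega] h.
Proof.
move=> [mT muT] mh hB; congr fine.
have mhT : measurable_fun setT (h \o T) by exact: measurableT_comp.
have := @integral_pushforward _ _ _ _ R T mT mu setT (EFin \o h).
rewrite preimage_setT => <- //.
- by apply: eq_measure_integral => A mA _; exact: muT.
- exact/measurable_EFinP.
- exact: (bounded_integrable mhT (fun w => hB (T w))).
Qed.

Lemma measurable_iter n :
  measurable_fun [set: Omega] T -> measurable_fun [set: Omega] (iter n T).
Proof.
move=> mT; elim: n => [|n ih]; first exact: measurable_id.
exact: (measurableT_comp mT ih).
Qed.

Definition birkhoff_sum h n w : R := \sum_(k < n) h (iter k T w).

Lemma birkhoff_sumS h n w :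
  birkhoff_sum h n.+1 w = h w + birkhoff_sum h n (T w).
Proof.
rewrite /birkhoff_sum big_ord_recl; congr (_ + _).
by apply: eq_bigr => i _; rewrite /= -iterSr.
Qed.

Fixpoint birkhoff_max h n w : R :=
  if n is m.+1 then Num.max 0 (h w + birkhoff_max h m (T w)) else 0.

Lemma birkhoff_max_ge0 h n w : 0 <= birkhoff_max h n w.
Proof. by case: n => [|n] //=; rewrite le_max lexx. Qed.

Lemma birkhoff_sum_le_max h n w : birkhoff_sum h n w <= birkhoff_max h n w.
Proof.
elim: n w => [|n ih] w; first by rewrite /birkhoff_sum big_ord0.
by rewrite birkhoff_sumS /= le_max lerD2l ih orbT.
Qed.

Lemma birkhoff_maxS h n w : birkhoff_max h n w <= birkhoff_max h n.+1 w.
Proof.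
elim: n w => [|n ih] w; first by rewrite /= le_max lexx.
rewrite [leLHS]/= [leRHS]/= ge_max le_max lexx /= le_max; apply/orP; right.
by rewrite lerD2l ih.
Qed.

Lemma birkhoff_max_mono h m n w :
  (m <= n)%N -> birkhoff_max h m w <= birkhoff_max h n w.
Proof.
move=> /subnK <-; elim: (n - m)%N => [|k ih]//.
by rewrite (le_trans ih)// addSn birkhoff_maxS.
Qed.

Lemma measurable_birkhoff_max h n :
  measurable_fun [set: Omega] T -> measurable_fun [set: Omega] h ->
  measurable_fun [set: Omega] (birkhoff_max h n).
Proof.
move=> mT mh; elim: n => [|n ih]; first exact: measurable_cst.
apply: measurable_maxr; first exact: measurable_cst.
by apply: measurable_funD => //; apply: measurableT_comp.
Qed.

Lemma birkhoff_max_bound h (B : R) n w : (forall w, `|h w| <= B) ->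
  `|birkhoff_max h n w| <= B *+ n.
Proof.
move=> hB; have B0 : 0 <= B by rewrite (le_trans _ (hB w)).
elim: n w => [|n ih] w; first by rewrite /= normr0.
rewrite ger0_norm ?birkhoff_max_ge0//= ge_max mulrn_wge0//= mulrS lerD//.
  by rewrite (le_trans (ler_norm _)).
by rewrite (le_trans (ler_norm _)).
Qed.

Definition birkhoff_unbounded h : set Omega :=
  [set w | forall M : nat, exists n, M%:R < birkhoff_max h n w].

Lemma measurable_birkhoff_unbounded h :
  measurable_fun [set: Omega] T -> measurable_fun [set: Omega] h ->
  measurable (birkhoff_unbounded h).
Proof.
move=> mT mh.
have -> : birkhoff_unbounded h =
    \bigcap_M \bigcup_n (birkhoff_max h n @^-1` `]M%:R, +oo[%classic).
  apply/seteqP; split => w /=.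
    by move=> + M _ => /(_ M)[n ?]; exists n => //=; rewrite in_itv/= andbT.
  by move=> + M => /(_ M I)[n _ /=]; rewrite in_itv/= andbT; exists n.
apply: bigcapT_measurable => M; apply: bigcupT_measurable => n.
rewrite -[X in measurable X]setTI.
exact: measurable_birkhoff_max.
Qed.

(** The recursion [F_(n+1) = max (0, h + F_n o T)] shows that the maxima at [w] and
    at [T w] differ by a bounded amount, so they are unbounded together. *)
Lemma birkhoff_unbounded_invariant h :
  T @^-1` birkhoff_unbounded h = birkhoff_unbounded h.
Proof.
apply/seteqP; split => w /= hw M.
- have [n hn] := hw (Num.bound `|M%:R - h w|).
  exists n.+1; rewrite /= lt_max -ltrBlDl; apply/orP; right.
  apply: le_lt_trans hn; apply: le_trans (ler_norm _) _.
  exact: ltW (archi_boundP (normr_ge0 _)).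
- have [n hn] := hw (Num.bound `|M%:R + h w|).
  have {}hn := lt_le_trans hn (birkhoff_maxS h n w).
  exists n; move: hn; rewrite /= lt_max => /orP[|hn].
    by rewrite ltNge ler0n.
  suff : M%:R + h w < h w + birkhoff_max h n (T w) by rewrite addrC ltrD2l.
  apply: le_lt_trans hn; apply: le_trans (ler_norm _) _.
  exact: ltW (archi_boundP (normr_ge0 _)).
Qed.

Lemma birkhoff_maxB h n w :
  birkhoff_max h n.+1 w - birkhoff_max h n (T w) =
  Num.max (- birkhoff_max h n (T w)) (h w).
Proof. by rewrite /= addr_maxl sub0r addrK. Qed.

(** With [F_n] the running maxima, the set where they are unbounded is invariant,
    hence null or of full measure.  In the latter case [F_(n+1) - F_n o T] is
    [max (h, - F_n o T)], which converges boundedly to [h] almost everywhere;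
    but [T] preserves the measure and [F_n] increases, so these functions have
    nonnegative integrals, and then so has [h]. *)
Lemma birkhoff_sum_bounded_above h (B : R) : ergodic mu T ->
  measurable_fun [set: Omega] h -> (forall w, `|h w| <= B) ->
  Rintegral mu [set: Omega] h < 0 ->
  {ae mu, forall w, exists M : R, forall n, birkhoff_sum h n w <= M}.
Proof.
move=> [mpT ergT] mh hB ih0; have [mT muT] := mpT.
have mE := measurable_birkhoff_unbounded mT mh.
have mF n := measurable_birkhoff_max n mT mh.
have mFT n : measurable_fun setT (birkhoff_max h n \o T).
  exact: measurableT_comp.
case: (ergT _ mE (birkhoff_unbounded_invariant h)) => [E0|E1].
  exists (birkhoff_unbounded h); split => // w /= + M; apply: contra_notP.
  move=> /forallNP hM; exists M%:R => n.
  by rewrite (le_trans (birkhoff_sum_le_max h n w))// leNgt; apply/negP/hM.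
exfalso.
(* From here on [birkhoff_unbounded h] has full measure. *)
pose D n w := birkhoff_max h n.+1 w - birkhoff_max h n (T w).
have mD n : measurable_fun setT (D n) by exact: (measurable_funB (mF n.+1) (mFT n)).
have DB n w : `|D n w| <= B.
  rewrite /D birkhoff_maxB ler_norml; apply/andP; split.
    rewrite le_max; apply/orP; right.
    by have := hB w; rewrite ler_norml => /andP[].
  rewrite ge_max; apply/andP; split; apply: le_trans (hB w); last exact: ler_norm.
  by apply: le_trans (normr_ge0 _); rewrite oppr_le0 birkhoff_max_ge0.
have ID n : 0 <= Rintegral mu setT (D n).
  rewrite /D RintegralB//; last 2 first.
  - by apply: bounded_integrable => // w; apply: birkhoff_max_bound.
  - apply: (bounded_integrable (mFT n)) => w; exact: birkhoff_max_bound.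
  rewrite (@Rintegral_measure_preserving _ (B *+ n))//; last first.
    by move=> w; apply: birkhoff_max_bound.
  rewrite subr_ge0; apply: le_Rintegral => //.
  - by apply: bounded_integrable => // w; apply: birkhoff_max_bound.
  - by apply: bounded_integrable => // w; apply: birkhoff_max_bound.
  - by move=> w _; apply: birkhoff_maxS.
have [] := @dominated_convergence _ _ R mu setT measurableT
   (fun n => EFin \o D n) (EFin \o h) (cst B%:E).
- by move=> n; exact/measurable_EFinP.
- exact/measurable_EFinP.
- exists (~` birkhoff_unbounded h); split.
  + exact: measurableC.
  + by apply: etrans (probability_setC mu mE) _; rewrite E1 subee.
  + move=> w /=; apply: contra_not => Ew _.
    rewrite -birkhoff_unbounded_invariant in Ew.
    have [n0 hn0] := Ew (Num.bound `|h w|).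
    apply: cvg_near_cst; exists n0 => // n /= n0n.
    rewrite /D birkhoff_maxB; congr (_%:E); apply/max_idPr; rewrite lerNl.
    rewrite (le_trans (ler_norm _))// normrN.
    rewrite (le_trans (ltW (archi_boundP (normr_ge0 _))))//.
    by rewrite (le_trans (ltW hn0))// birkhoff_max_mono.
- exact: finite_measure_integrable_cst.
- by apply: nearW => w n _ /=; rewrite lee_fin.
move=> ih _ cvD.
suff : (0 <= \int[mu]_x (EFin \o h) x)%E.
  by move=> /fine_ge0; apply/negP; rewrite -ltNge; exact: ih0.
rewrite -(cvg_lim _ cvD)//; apply: lime_ge; first by apply/cvg_ex; eexists; exact: cvD.
apply: nearW => n.
have iD := bounded_integrable (mD n) (DB n).
by rewrite -[leRHS](fineK (integrable_fin_num measurableT iD)) lee_fin; exact: ID.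
Qed.

Lemma birkhoff_sum_le_linear h (B e : R) : ergodic mu T ->
  measurable_fun [set: Omega] h -> (forall w, `|h w| <= B) ->
  Rintegral mu [set: Omega] h < e ->
  {ae mu, forall w, exists M : R, forall n, birkhoff_sum h n w <= e * n%:R + M}.
Proof.
move=> ergT mh hB he; pose k w := h w - e.
have mk : measurable_fun [set: Omega] k by exact: measurable_funB.
have kB w : `|k w| <= B + `|e| by rewrite (le_trans (ler_normB _ _))// lerD2r.
have ik : Rintegral mu [set: Omega] k < 0.
  rewrite /k RintegralB//; last 2 first.
  - exact: bounded_integrable hB.
  - by apply: (@bounded_integrable _ `|e|) => //; apply: measurable_cst.
  by rewrite Rintegral_cst//= probability_setT mulr1 subr_lt0.
have := birkhoff_sum_bounded_above ergT mk kB ik.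
apply: filterS => w [M kM]; exists M => n; have := kM n.
rewrite /birkhoff_sum big_split/= sumr_const card_ord mulNrn mulr_natr.
by rewrite lerBlDl.
Qed.

End BirkhoffSums.

(** * Interpolation and Chebyshev polynomials *)

Section Interpolation.

(** Comparison of leading coefficients in the Lagrange interpolation formula. *)
Lemma coef_interpolation (F : fieldType) n (x : 'I_n.+1 -> F) (p : {poly F}) :
  injective x -> (size p <= n.+1)%N ->
  p`_n = \sum_(j < n.+1) p.[x j] / \prod_(i < n.+1 | i != j) (x j - x i).
Proof.
move=> xI sp; pose N (j : 'I_n.+1) := \prod_(i < n.+1 | i != j) ('X - (x i)%:P).
pose D (j : 'I_n.+1) := \prod_(i < n.+1 | i != j) (x j - x i).
have sN j : size (N j) = n.+1.
  rewrite /N -big_filter size_prod_XsubC; congr _.+1.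
  by rewrite size_filter -sum1_count sum1_card cardC1 card_ord.
have Nn j : (N j)`_n = 1.
  have /monicP := monic_prod_XsubC (index_enum 'I_n.+1) (fun i => i != j) x.
  by rewrite lead_coefE sN.
have ND j : (N j).[x j] = D j.
  by rewrite horner_prod; apply: eq_bigr => i _; rewrite hornerXsubC.
have N0 j k : k != j -> (N j).[x k] = 0.
  by move=> kj; rewrite horner_prod (bigD1 k)//= hornerXsubC subrr mul0r.
have D0 j : D j != 0.
  by apply/prodf_neq0 => i ij; rewrite subr_eq0 (inj_eq xI) eq_sym.
pose q := \sum_(j < n.+1) (p.[x j] / D j) *: N j.
suff -> : p = q.
  rewrite coef_sum; apply: eq_bigr => j _; rewrite coefZ Nn mulr1; congr (_ / _).
  rewrite horner_sum (bigD1 j)//= hornerZ ND divfK// big1 ?addr0// => k kj.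
  by rewrite hornerZ N0 1?eq_sym// mulr0.
apply/eqP; rewrite -subr_eq0; apply/eqP.
apply: (@roots_geq_poly_eq0 _ _ [seq x i | i <- enum 'I_n.+1]).
- apply/allP => _ /mapP[k _ ->]; rewrite rootE hornerD hornerN.
  rewrite horner_sum (bigD1 k)//= hornerZ ND divfK// big1 ?addr0 ?subrr// => j jk.
  by rewrite hornerZ N0 1?eq_sym// mulr0.
- by rewrite map_inj_uniq// enum_uniq.
- rewrite size_map size_enum_ord (leq_trans (size_polyD _ _))// geq_max sp size_polyN.
  apply: (leq_trans (size_sum _ _ _)); apply/bigmax_leqP => j _.
  by rewrite (leq_trans (size_scale_leq _ _))// sN.
Qed.

End Interpolation.

Section Chebyshev.
Context {R : realType}.

(** Carrying two consecutive polynomials makes the three-term recursion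
    structural. *)
Fixpoint chebyshev_pair (n : nat) : {poly R} * {poly R} :=
  if n is m.+1 then
    let: (p, q) := chebyshev_pair m in (q, 2 *: ('X * q) - p)
  else (1, 'X).

Definition chebyshev n := (chebyshev_pair n).1.

Lemma chebyshevSS n :
  chebyshev n.+2 = 2 *: ('X * chebyshev n.+1) - chebyshev n.
Proof. by rewrite /chebyshev /=; case: (chebyshev_pair n). Qed.

Lemma two_step_ind (P : nat -> Prop) :
  P 0%N -> P 1%N -> (forall n, P n -> P n.+1 -> P n.+2) -> forall n, P n.
Proof.
move=> P0 P1 PS n; suff [] : P n /\ P n.+1 by [].
by elim: n => // n [Pn Pn1]; split => //; exact: PS.
Qed.

Lemma chebyshev_cos n (x : R) : (chebyshev n).[cos x] = cos (n%:R * x).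
Proof.
elim/two_step_ind: n => [||n ih ih1].
- by rewrite /chebyshev /= hornerC mul0r cos0.
- by rewrite /chebyshev /= hornerX mul1r.
- rewrite chebyshevSS hornerD hornerN hornerZ hornerM hornerX ih ih1.
  have -> : n.+2%:R * x = n.+1%:R * x + x by rewrite -[n.+2]addn1 natrD mulrDl mul1r.
  have -> : n%:R * x = n.+1%:R * x - x.
    by rewrite -[n.+1]addn1 natrD mulrDl mul1r addrK.
  by rewrite cosB cosD; ring.
Qed.

Lemma size_chebyshev n : (size (chebyshev n) <= n.+1)%N.
Proof.
elim/two_step_ind: n => [||n ih ih1].
- by rewrite /chebyshev /= size_poly1.
- by rewrite /chebyshev /= size_polyX.
- rewrite chebyshevSS (leq_trans (size_polyD _ _))// geq_max size_polyN.
  apply/andP; split; last by rewrite (leq_trans ih)// leqW.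
  rewrite (leq_trans (size_scale_leq _ _))// (leq_trans (size_polyMleq _ _))//.
  by rewrite size_polyX.
Qed.

Lemma coef_chebyshev n : (chebyshev n.+1)`_n.+1 = 2 ^+ n.
Proof.
elim: n => [|n ih]; first by rewrite /chebyshev /= coefX.
rewrite chebyshevSS coefB coefZ coefXM /= ih exprS.
by rewrite [X in _ - X]nth_default ?subr0// (leq_trans (size_chebyshev n)).
Qed.

(** The points of [[-1, 1]] where the Chebyshev polynomial of degree [n] reaches
    its extreme values. *)
Definition chebyshev_node n (i : 'I_n.+1) : R := cos (i%:R * (pi / n%:R)).

Lemma chebyshev_node_angle n (i : 'I_n.+1) : (0 < n)%N ->
  i%:R * (pi / n%:R) \in `[0, (pi : R)].
Proof.
move=> n0; rewrite in_itv/=; apply/andP; split.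
  by rewrite mulr_ge0// divr_ge0// pi_ge0.
rewrite mulrA ler_pdivrMr ?ltr0n// mulrC ler_wpM2l ?pi_ge0//.
by rewrite ler_nat -ltnS.
Qed.

Lemma chebyshev_node_lt n (i j : 'I_n.+1) : (0 < n)%N ->
  (chebyshev_node i < chebyshev_node j) = (j < i)%N.
Proof.
move=> n0; rewrite ltr_cos; [|exact: chebyshev_node_angle..].
by rewrite ltr_pM2r ?ltr_nat// divr_gt0 ?pi_gt0 ?ltr0n.
Qed.

Lemma chebyshev_at_node n (i : 'I_n.+1) : (0 < n)%N ->
  (chebyshev n).[chebyshev_node i] = (-1) ^+ i.
Proof.
move=> n0; rewrite chebyshev_cos mulrCA [_%:R * (pi / _)]mulrC divfK ?pnatr_eq0 -?lt0n//.
rewrite mulrC; elim: (nat_of_ord i) => [|k ih]; first by rewrite mulr0 cos0.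
by rewrite -natr1 mulrDr mulr1 cosDpi ih exprS mulN1r.
Qed.

(** The nodes decrease with the index, so exactly the factors with [i < j] are
    negative. *)
Lemma chebyshev_node_prod n (j : 'I_n.+1) : (0 < n)%N ->
  \prod_(i < n.+1 | i != j) (chebyshev_node j - chebyshev_node i) =
  (-1) ^+ j *
  \prod_(i < n.+1 | i != j) `|chebyshev_node j - chebyshev_node i|.
Proof.
move=> n0.
have -> : (-1 : R) ^+ j = \prod_(i < n.+1 | i != j) (if (i < j)%N then -1 else 1).
  have -> : (-1 : R) ^+ j = \prod_(i < j) (-1).
    by rewrite prodr_const card_ord.
  rewrite (big_ord_widen n.+1 (fun=> -1))/=; last exact: ltnW.
  rewrite [LHS]big_mkcond [RHS]big_mkcond/=; apply: eq_bigr => i _.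
  by case: (eqVneq i j) => [->|//]; rewrite ltnn.
rewrite -big_split/=; apply: eq_bigr => i ij.
have [h|h|/ord_inj h] := ltngtP i j; last by rewrite h eqxx in ij.
- by rewrite ltr0_norm ?mulN1r ?opprK// subr_lt0 chebyshev_node_lt.
- by rewrite gtr0_norm ?mul1r// subr_gt0 chebyshev_node_lt.
Qed.

(** Interpolating the Chebyshev polynomial at its own extrema: its values
    alternate in sign exactly as the denominators do, so no cancellation occurs
    and the sum is its leading coefficient. *)
Lemma chebyshev_node_sum n : (0 < n)%N ->
  \sum_(j < n.+1)
    (\prod_(i < n.+1 | i != j) `|chebyshev_node j - chebyshev_node i|)^-1
  = 2 ^+ n.-1.
Proof.
move=> n0.
have nodeI : injective (@chebyshev_node n).
  move=> i j ij; apply: val_inj => /=; apply/eqP.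
  rewrite eqn_leq leqNgt -chebyshev_node_lt// ij ltxx/=.
  by rewrite leqNgt -chebyshev_node_lt// ij ltxx.
have := coef_interpolation nodeI (size_chebyshev n).
rewrite -{1 2}(prednK n0) coef_chebyshev => ->; apply: eq_bigr => j _.
rewrite chebyshev_at_node// chebyshev_node_prod//.
by rewrite invfM mulrA mulfV ?mul1r// signr_eq0.
Qed.

End Chebyshev.

(** * Spreading out points of a compact set *)

Section CompactStretch.
Context {R : realType}.
Local Notation leb := (@lebesgue_measure R).

Definition measure_below (K : set R) (x : R) : R := fine (leb (K `&` `]-oo, x])).

Lemma measure_belowE K x : compact K ->
  leb (K `&` `]-oo, x]) = (measure_below K x)%:E.
Proof.
move=> cK; rewrite /measure_below fineK// ge0_fin_numE//.
have mK := compact_measurable cK.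
apply: le_lt_trans (compact_finite_measure cK).
by apply: le_measure; rewrite ?inE//; apply: measurableI.
Qed.

Lemma measure_below_mono K x y : compact K -> x <= y ->
  measure_below K x <= measure_below K y.
Proof.
move=> cK xy; rewrite -lee_fin -!measure_belowE//.
have mK := compact_measurable cK.
apply: le_measure; rewrite ?inE//; [exact: measurableI..|].
apply: setIS => z /=; rewrite !in_itv/= => zx; exact: le_trans xy.
Qed.

Lemma measure_below_add K x y : compact K -> x <= y ->
  measure_below K y <= measure_below K x + (y - x).
Proof.
move=> cK xy; rewrite -lee_fin EFinD -!measure_belowE//.
have mK := compact_measurable cK.
have -> : (y - x)%:E = leb `]x, y].
  by rewrite lebesgue_measure_itv/= lte_fin; case: ltgtP xy => // ->; rewrite subrr.
apply: le_trans (measureU2 leb _ _); [|exact: measurableI|by []].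
apply: le_measure; rewrite ?inE//; first exact: measurableI.
  by apply: measurableU => //; exact: measurableI.
move=> z [Kz] /=; rewrite !in_itv/= => zy.
by have [zx|xz] := leP z x; [left|right].
Qed.

(** The gain between [x] and [y] is the measure of a subset of an interval of
    length [y - x]. *)
Lemma measure_below_lipschitz K x y : compact K ->
  `|measure_below K x - measure_below K y| <= `|x - y|.
Proof.
move=> cK; wlog xy : x y / x <= y => [H|].
  have [xy|/ltW yx] := leP x y; first exact: H.
  by rewrite distrC [leRHS]distrC; exact: H.
rewrite distrC [leRHS]distrC ger0_norm ?subr_ge0 ?measure_below_mono//.
by rewrite ger0_norm ?subr_ge0// lerBlDl measure_below_add.
Qed.

Lemma measure_below_continuous K : compact K -> continuous (measure_below K).
Proof.
move=> cK x; apply/cvgrPdist_le => e e0.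
have /cvgrPdist_le/(_ e e0) := @cvg_id _ (nbhs x).
by apply: filterS => y; apply: le_trans; exact: measure_below_lipschitz.
Qed.

(** The intermediate value theorem gives a real point with the right value; moving
    it left to the nearest point of [K] does not change the value, unless nothing
    of [K] lies there, in which case the value is [0] and the least point of [K]
    will do. *)
Lemma measure_below_surj K t : compact K -> K !=set0 ->
  0 <= t <= fine (leb K) -> exists2 x, K x & measure_below K x = t.
Proof.
move=> cK K0 tK; have [N [_ KN]] := compact_bounded cK.
pose b := `|N| + 1.
have {}KN x : K x -> - b <= x <= b.
  move=> Kx; rewrite -ler_norml; apply: KN => //.
  by rewrite /b (le_lt_trans (ler_norm N))// ltrDl.
have b0 : 0 <= b by rewrite addr_ge0.
have Ka : measure_below K (- b - 1) = 0.
  rewrite /measure_below [X in leb X](_ : _ = set0) ?measure0//.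
  apply/seteqP; split => // x [Kx] /=; rewrite in_itv/= => xb.
  have /andP[bx _] := KN _ Kx; have := le_trans bx xb; lra.
have Kb : measure_below K b = fine (leb K).
  rewrite /measure_below [X in leb X](_ : _ = K)//.
  apply/seteqP; split => [x []//|x Kx]; split => //=; rewrite in_itv/=.
  by have /andP[] := KN _ Kx.
have [|||c _ ct] := @IVT _ (measure_below K) (- b - 1) b t.
- lra.
- by apply: continuous_subspaceT; exact: measure_below_continuous.
- rewrite Ka Kb; case/andP: tK => t0 tm.
  by rewrite ge_min t0/= le_max tm orbT.
have cKc : compact (K `&` `]-oo, c]).
  by apply: compact_closedI => //; exact: rray_closed.
have idc A : {within A, continuous (@id R)}.
  by apply: continuous_subspaceT => x; exact: cvg_id.
have [/(compact_EVT_max)/(_ cKc (idc _))[y /set_mem[Ky yc] ymax]|Kc0] :=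
    pselect (K `&` `]-oo, c] !=set0).
  exists y => //; rewrite -ct /measure_below; congr (fine (leb _)).
  apply/seteqP; split => x [Kx xy]; split => //=; rewrite in_itv/=.
    by move: xy yc; rewrite /= !in_itv/=; exact: le_trans.
  by apply: ymax; rewrite inE.
have [y /set_mem Ky ymin] := compact_EVT_min K0 cK (idc _).
exists y => //.
have -> : t = 0.
  rewrite -ct /measure_below [X in leb X](_ : _ = set0) ?measure0//.
  by apply/seteqP; split => // x Kx; apply: Kc0; exists x.
rewrite /measure_below [X in leb X](_ : _ = [set y]) ?lebesgue_measure_set1//.
apply/seteqP; split => [x [Kx] /=|_ ->]; last by split => //=; rewrite in_itv/=.
rewrite in_itv/= => xy; apply/eqP; rewrite eq_le xy/=.
by apply: ymin; rewrite inE.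
Qed.

(** Choosing points where [measure_below K] takes the values [t i] works because
    that function does not increase distances. *)
Lemma compact_stretch K (I : Type) (t : I -> R) : compact K -> K !=set0 ->
  (forall i, 0 <= t i <= fine (leb K)) ->
  exists x : I -> R, (forall i, K (x i)) /\
    (forall i j, `|t i - t j| <= `|x i - x j|).
Proof.
move=> cK K0 tK.
have /choice[x xP] : forall i, exists x, K x /\ measure_below K x = t i.
  by move=> i; have [x] := measure_below_surj cK K0 (tK i); exists x.
exists x; split => [i|i j]; first by have [] := xP i.
by have [_ <-] := xP i; have [_ <-] := xP j; exact: measure_below_lipschitz.
Qed.

End CompactStretch.

(** * Polya's inequality *)

(** The extrema of the Chebyshev polynomial are scaled to an interval whose length
    is the measure [m] of [K] and transported into [K]; the interpolation formula
    for the leading coefficient [1] of [p] then gives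
    [1 <= c * (m / 2)^(-n) * 2^(n-1)]. *)
Lemma polya_inequality (R : realType) (K : set R) (p : {poly R}) n (c : R) :
  (0 < n)%N -> compact K -> p \is monic -> size p = n.+1 -> 0 <= c ->
  (forall x, K x -> `|p.[x]| <= c) ->
  2 * (fine (lebesgue_measure K) / 4) ^+ n <= c.
Proof.
move=> n0 cK pm sp c0 pc; set m := fine _.
have [m0|m0] : m <= 0 \/ 0 < m by case: (leP m 0); [left|right].
  have -> : m = 0 by apply/eqP; rewrite eq_le m0 fine_ge0.
  by rewrite mul0r expr0n eqn0Ngt n0/= mulr0.
have K0 : K !=set0.
  apply/set0P/eqP => KE; move: m0; rewrite /m KE measure0.
  by rewrite ltxx.
pose s := @chebyshev_node R n.
have sE i : -1 <= s i <= 1 by rewrite cos_geN1 cos_le1.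
have sI i j : i != j -> s i != s j.
  move=> ij; have : (i < j)%N || (j < i)%N by rewrite -neq_ltn.
  rewrite -!(chebyshev_node_lt (R := R) _ _ n0) => /orP[]/lt_eqF; last by move=> ->.
  by rewrite eq_sym => ->.
(* The affine map [u |-> m / 2 * (u + 1)] sends [[-1, 1]] onto [[0, m]]. *)
have [i|x [Kx xs]] := compact_stretch (t := fun i => m / 2 * (s i + 1)) cK K0.
  have := sE i; rewrite -/m => /andP[s1 s2]; apply/andP; split; last by nra.
  by apply: mulr_ge0; lra.
have {}xs i j : m / 2 * `|s i - s j| <= `|x i - x j|.
  apply: le_trans (xs i j); rewrite -mulrBr normrM gtr0_norm ?divr_gt0//.
  by rewrite opprD addrACA subrr addr0.
have xI : injective x.
  move=> i j /eqP; rewrite -subr_eq0 => /eqP xij; apply/eqP/negPn/negP => ij.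
  have := xs i j; rewrite xij normr0 leNgt mulr_gt0 ?divr_gt0//.
  by rewrite normr_gt0 subr_eq0 sI.
have := coef_interpolation xI (eq_leq sp).
have -> : p`_n = 1 by have /monicP := pm; rewrite lead_coefE sp.
move=> /(congr1 Num.norm); rewrite normr1 => E.
have P0 j : 0 < \prod_(i < n.+1 | i != j) `|s j - s i|.
  by apply: prodr_gt0 => i ij; rewrite normr_gt0 subr_eq0 sI// eq_sym.
have : 1 <= \sum_(j < n.+1)
    c * (m / 2) ^- n * (\prod_(i < n.+1 | i != j) `|s j - s i|)^-1.
  rewrite {1}E (le_trans (ler_norm_sum _ _ _))//; apply: ler_sum => j _.
  rewrite normrM normfV normr_prod -mulrA -invfM.
  have Q0 : 0 < (m / 2) ^+ n * \prod_(i < n.+1 | i != j) `|s j - s i|.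
    by rewrite mulr_gt0// exprn_gt0// divr_gt0.
  apply: ler_pM => //; [by rewrite invr_ge0; apply: prodr_ge0|exact: pc|].
  rewrite lef_pV2 ?posrE//; last first.
    by apply: prodr_gt0 => i ij; rewrite normr_gt0 subr_eq0 (inj_eq xI) eq_sym.
  have -> : (m / 2) ^+ n = \prod_(i < n.+1 | i != j) (m / 2).
    by rewrite prodr_const cardC1 card_ord.
  rewrite -big_split/=; apply: ler_prod => i _.
  by rewrite xs andbT mulr_ge0// divr_ge0// ltW.
rewrite -big_distrr/= (chebyshev_node_sum n0).
rewrite mulrAC ler_pdivlMr ?exprn_gt0 ?divr_gt0// mul1r => h.
rewrite -(ler_pM2r (_ : 0 < 2 ^+ n.-1)) ?exprn_gt0//.
apply: le_trans h; have -> : m / 2 = m / 4 * 2 by field.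
have E2 : (2 : R) ^+ n = 2 * 2 ^+ n.-1 by rewrite -exprS prednK.
by rewrite [leRHS]exprMn E2 mulrCA mulrA.
Qed.

(** * The operator norm of a real two by two matrix *)

Section RealOperatorNorm.
Context {R : realType}.
Implicit Types (M : 'M[R]_2) (x y : R).

(** The squared Euclidean norm of [M] applied to the real vector [(x, y)]. *)
Definition sqnorm_image M x y : R :=
  (M ord0 ord0 * x + M ord0 ord_max * y) ^+ 2 +
  (M ord_max ord0 * x + M ord_max ord_max * y) ^+ 2.

(** The larger root of the characteristic polynomial of [M^T M].  An explicit
    formula makes measurability of the operator norm evident. *)
Definition gram_top_eigenvalue M : R :=
  let p := M ord0 ord0 ^+ 2 + M ord_max ord0 ^+ 2 in
  let q := M ord0 ord0 * M ord0 ord_max + M ord_max ord0 * M ord_max ord_max in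
  let r := M ord0 ord_max ^+ 2 + M ord_max ord_max ^+ 2 in
  (p + r + Num.sqrt ((p - r) ^+ 2 + 4 * q ^+ 2)) / 2.

Lemma quadratic_form_top (p q r : R) :
  let l := (p + r + Num.sqrt ((p - r) ^+ 2 + 4 * q ^+ 2)) / 2 in
  [/\ p <= l, r <= l & (l - p) * (l - r) = q ^+ 2].
Proof.
have D0 : 0 <= (p - r) ^+ 2 + 4 * q ^+ 2.
  by rewrite addr_ge0 ?sqr_ge0// mulr_ge0 ?sqr_ge0.
have sp : `|p - r| <= Num.sqrt ((p - r) ^+ 2 + 4 * q ^+ 2).
  by rewrite -sqrtr_sqr ler_wsqrtr// lerDl mulr_ge0// sqr_ge0.
have := sqr_sqrtr D0; move: sp; set s := Num.sqrt _ => sp sE l; rewrite {}/l.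
move: sp; rewrite ler_norml => /andP[s1 s2].
split; [lra|lra|].
have -> : (p + r + s) / 2 - p = (s - (p - r)) / 2 by field.
have -> : (p + r + s) / 2 - r = (s + (p - r)) / 2 by field.
have -> : (s - (p - r)) / 2 * ((s + (p - r)) / 2) = (s ^+ 2 - (p - r) ^+ 2) / 4.
  by field.
by rewrite sE; field.
Qed.

(** The difference of the two sides is a quadratic form with nonnegative diagonal
    and zero determinant; multiplying by a diagonal entry completes the square. *)
Lemma sqnorm_image_le M x y :
  sqnorm_image M x y <= gram_top_eigenvalue M * (x ^+ 2 + y ^+ 2).
Proof.
rewrite /sqnorm_image /gram_top_eigenvalue.
move: (M ord0 ord0) (M ord0 ord_max) (M ord_max ord0) (M ord_max ord_max) => a b c e /=.
have := quadratic_form_top (a ^+ 2 + c ^+ 2) (a * b + c * e) (b ^+ 2 + e ^+ 2).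
set p := a ^+ 2 + c ^+ 2; set q := a * b + c * e; set r := b ^+ 2 + e ^+ 2.
move=> /=; set l := (_ / 2) => -[pl rl lE].
rewrite -subr_ge0.
have -> : l * (x ^+ 2 + y ^+ 2) - ((a * x + b * y) ^+ 2 + (c * x + e * y) ^+ 2)
   = (l - p) * x ^+ 2 + (l - r) * y ^+ 2 - 2 * q * x * y.
  by rewrite /p /q /r; ring.
move: pl; rewrite le_eqVlt => /predU1P[pl|pl].
  have /eqP : q ^+ 2 = 0 by rewrite -lE pl subrr mul0r.
  rewrite sqrf_eq0 => /eqP ->; rewrite pl.
  have : 0 <= (l - r) * y ^+ 2 by rewrite mulr_ge0 ?sqr_ge0// subr_ge0.
  lra.
rewrite -(pmulr_rge0 _ (_ : 0 < l - p)) ?subr_gt0//.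
have -> : (l - p) * ((l - p) * x ^+ 2 + (l - r) * y ^+ 2 - 2 * q * x * y) =
  ((l - p) * x - q * y) ^+ 2 + ((l - p) * (l - r) - q ^+ 2) * y ^+ 2 by ring.
by rewrite lE subrr mul0r addr0 sqr_ge0.
Qed.

(** The eigenvector [(q, l - p)] works, unless it vanishes; then the first basis
    vector does. *)
Lemma sqnorm_image_attained M : exists x y,
  x ^+ 2 + y ^+ 2 = 1 /\ sqnorm_image M x y = gram_top_eigenvalue M.
Proof.
rewrite /sqnorm_image /gram_top_eigenvalue.
move: (M ord0 ord0) (M ord0 ord_max) (M ord_max ord0) (M ord_max ord_max) => a b c e /=.
have := quadratic_form_top (a ^+ 2 + c ^+ 2) (a * b + c * e) (b ^+ 2 + e ^+ 2).
set p := a ^+ 2 + c ^+ 2; set q := a * b + c * e; set r := b ^+ 2 + e ^+ 2.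
move=> /=; set l := (_ / 2) => -[pl rl lE].
have [lp|lp] := eqVneq l p.
  by exists 1, 0; split; [ring|rewrite lp /p; ring].
have n0 : 0 < q ^+ 2 + (l - p) ^+ 2.
  by rewrite ltr_wpDl ?sqr_ge0// exprn_even_gt0//= subr_eq0.
pose n := Num.sqrt (q ^+ 2 + (l - p) ^+ 2).
have nE : n ^+ 2 = q ^+ 2 + (l - p) ^+ 2 by rewrite sqr_sqrtr// ltW.
have nn0 : n != 0 by rewrite gt_eqF// sqrtr_gt0.
exists (q / n), ((l - p) / n); split.
  by rewrite !expr_div_n -mulrDl -nE mulfV// sqrf_eq0.
have -> : (a * (q / n) + b * ((l - p) / n)) ^+ 2 + (c * (q / n) + e * ((l - p) / n)) ^+ 2
   = (p * q ^+ 2 + 2 * q * q * (l - p) + r * (l - p) ^+ 2) / n ^+ 2.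
  by rewrite /p /q /r; field.
apply/eqP; rewrite -(inj_eq (mulIf (_ : n ^+ 2 != 0))) ?sqrf_eq0//.
rewrite divfK ?sqrf_eq0//; apply/eqP; rewrite nE.
have -> : r * (l - p) ^+ 2 = (l - p) * (l * (l - p) - (l - p) * (l - r)) by ring.
by rewrite lE; ring.
Qed.

Lemma gram_top_eigenvalue_ge0 M : 0 <= gram_top_eigenvalue M.
Proof.
have [x [y [_ <-]]] := sqnorm_image_attained M.
by rewrite addr_ge0 ?sqr_ge0.
Qed.

Lemma sqr_normcE (z : R[i]) :
  Normc.normc z ^+ 2 = complex.Re z ^+ 2 + complex.Im z ^+ 2.
Proof. by case: z => a b /=; rewrite sqr_sqrtr// addr_ge0 ?sqr_ge0. Qed.

Lemma vec_normE (v : 'cV[R[i]]_2) : vec_norm v =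
  Num.sqrt (complex.Re (v ord0 ord0) ^+ 2 + complex.Re (v ord_max ord0) ^+ 2 +
   (complex.Im (v ord0 ord0) ^+ 2 + complex.Im (v ord_max ord0) ^+ 2)).
Proof.
rewrite /vec_norm big_ord_recl big_ord1 !sqr_normcE addrACA.
by have -> : lift ord0 ord0 = ord_max :> 'I_2 by exact: val_inj.
Qed.

Lemma vec_norm_image M (v : 'cV[R[i]]_2) :
  vec_norm (map_mx (real_complex R) M *m v) = Num.sqrt (
   sqnorm_image M (complex.Re (v ord0 ord0)) (complex.Re (v ord_max ord0)) +
   sqnorm_image M (complex.Im (v ord0 ord0)) (complex.Im (v ord_max ord0))).
Proof.
rewrite vec_normE !mxE !big_ord_recl !big_ord0.
have -> : lift ord0 ord0 = ord_max :> 'I_2 by exact: val_inj.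
rewrite !mxE /sqnorm_image; congr Num.sqrt.
case: (v ord0 ord0) (v ord_max ord0) => [a b] [a' b'] /=.
rewrite !mul0r !subr0 !addr0; ring.
Qed.

(** For a real matrix the real and imaginary parts of a complex vector are mapped
    separately, so complex vectors give no larger norm than real ones. *)
Lemma op_norm_real M :
  op_norm (map_mx (real_complex R) M) = Num.sqrt (gram_top_eigenvalue M).
Proof.
rewrite /op_norm; set S := (X in sup X).
have [x [y [xy1 xyM]]] := sqnorm_image_attained M.
have S1 : S (Num.sqrt (gram_top_eigenvalue M)).
  exists (\col_i (if i == ord0 then x%:C else y%:C)).
    by rewrite /= vec_normE !mxE/= !expr0n/= !addr0 xy1 sqrtr1.
  rewrite vec_norm_image !mxE/= xyM /sqnorm_image !mulr0 !addr0 expr0n/=.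
  by rewrite !addr0.
have S2 : ubound S (Num.sqrt (gram_top_eigenvalue M)).
  move=> _ [v /= v1 <-]; rewrite vec_norm_image ler_wsqrtr//.
  rewrite (le_trans (lerD (sqnorm_image_le _ _ _) (sqnorm_image_le _ _ _)))//.
  rewrite -mulrDr; move: v1; rewrite vec_normE => v1.
  set t := (X in _ * X <= _).
  have t0 : 0 <= t by rewrite !addr_ge0 ?sqr_ge0.
  by rewrite -(sqr_sqrtr t0) v1 expr1n mulr1.
apply/eqP; rewrite eq_le; apply/andP; split.
  by apply: ge_sup => //; exists (Num.sqrt (gram_top_eigenvalue M)).
by apply: ub_le_sup => //; exists (Num.sqrt (gram_top_eigenvalue M)).
Qed.

Definition real_op_norm M : R := op_norm (map_mx (real_complex R) M).

Lemma real_op_norm_ge0 M : 0 <= real_op_norm M.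
Proof. by rewrite /real_op_norm op_norm_real. Qed.

Lemma sqr_real_op_norm M : real_op_norm M ^+ 2 = gram_top_eigenvalue M.
Proof. by rewrite /real_op_norm op_norm_real sqr_sqrtr// gram_top_eigenvalue_ge0. Qed.

Lemma sqnorm_imageM M N x y : sqnorm_image (M *m N) x y =
  sqnorm_image M (N ord0 ord0 * x + N ord0 ord_max * y)
                 (N ord_max ord0 * x + N ord_max ord_max * y).
Proof.
rewrite /sqnorm_image !mxE !big_ord_recl !big_ord0.
have -> : lift ord0 ord0 = ord_max :> 'I_2 by exact: val_inj.
ring.
Qed.

(** Comparing the images of real vectors suffices, since the norm is attained at
    one of them. *)
Lemma real_op_norm_comparison M N (c : R) : 0 <= c ->
  (forall x y, sqnorm_image M x y <= c ^+ 2 * sqnorm_image N x y) ->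
  real_op_norm M <= c * real_op_norm N.
Proof.
move=> c0 MN; rewrite -(ler_pXn2r (ltn0Sn 1)) ?nnegrE ?mulr_ge0 ?real_op_norm_ge0//.
rewrite exprMn !sqr_real_op_norm.
have [x [y [xy1 <-]]] := sqnorm_image_attained M.
rewrite (le_trans (MN x y))// ler_wpM2l ?sqr_ge0//.
by rewrite (le_trans (sqnorm_image_le _ _ _))// xy1 mulr1.
Qed.

Lemma real_op_normM M N : real_op_norm (M *m N) <= real_op_norm M * real_op_norm N.
Proof.
apply: real_op_norm_comparison => [|x y]; first exact: real_op_norm_ge0.
by rewrite sqnorm_imageM (le_trans (sqnorm_image_le _ _ _))// sqr_real_op_norm.
Qed.

Lemma real_op_norm1 : real_op_norm 1%:M = 1.
Proof.
have H x y : sqnorm_image 1%:M x y = x ^+ 2 + y ^+ 2.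
  by rewrite /sqnorm_image !mxE/= !mul1r !mul0r addr0 add0r.
apply/eqP; rewrite -(@eqrXn2 _ 2)// ?real_op_norm_ge0// expr1n sqr_real_op_norm.
by have [x [y [xy1 <-]]] := sqnorm_image_attained 1%:M; rewrite H xy1.
Qed.

Lemma entry_le_real_op_norm M : `|M ord0 ord0| <= real_op_norm M.
Proof.
rewrite -(ler_pXn2r (ltn0Sn 1)) ?nnegrE ?real_op_norm_ge0// sqr_real_op_norm real_normK ?num_real//.
have := sqnorm_image_le M 1 0; rewrite /sqnorm_image.
rewrite !mulr0 !addr0 !mulr1 expr1n expr0n/= addr0 mulr1.
by apply: le_trans; rewrite lerDl sqr_ge0.
Qed.

Lemma measurable_real_op_norm d (Omega : measurableType d) (M : Omega -> 'M[R]_2) :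
  (forall i j, measurable_fun [set: Omega] (fun w => M w i j)) ->
  measurable_fun [set: Omega] (fun w => real_op_norm (M w)).
Proof.
move=> mM; rewrite /real_op_norm; under eq_fun do rewrite op_norm_real.
have msqrt : measurable_fun [set: R] (@Num.sqrt R).
  by apply: continuous_measurable_fun; exact: sqrt_continuous.
rewrite /gram_top_eigenvalue /=.
have mX i j : measurable_fun [set: Omega] (fun w => M w i j ^+ 2).
  exact: measurable_funX.
have mp := measurable_funD (mX ord0 ord0) (mX ord_max ord0).
have mr := measurable_funD (mX ord0 ord_max) (mX ord_max ord_max).
have mq := measurable_funD (measurable_funM (mM ord0 ord0) (mM ord0 ord_max))
  (measurable_funM (mM ord_max ord0) (mM ord_max ord_max)).
apply: (measurableT_comp msqrt); apply: measurable_funM => //.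
apply: measurable_funD; first exact: measurable_funD.
apply: (measurableT_comp msqrt); apply: measurable_funD.
  by apply: measurable_funX; exact: measurable_funB.
by apply: measurable_funM => //; exact: measurable_funX.
Qed.

End RealOperatorNorm.

(** * Subadditive sequences *)

Section SubadditiveBound.
Context {R : realType} {d : measure_display} {Omega : measurableType d}.
Variables (mu : probability Omega R) (T : Omega -> Omega).

(** The window sums [phi n + ... + phi (n + N - 1)] grow by
    [phi (n + N) - phi n], which subadditivity bounds by [phi N] at the [n]-th
    iterate.  Summing over [n] compares them with Birkhoff sums of [phi N], while
    the terms of one window differ from each other by a bounded amount. *)
Lemma subadditive_le_linear (phi : nat -> Omega -> R) (c e : R) (N : nat) :
  ergodic mu T ->
  (forall n, measurable_fun [set: Omega] (phi n)) ->
  (forall n w, `|phi n w| <= c * n%:R) ->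
  (forall n w, phi n w <= c + phi n.+1 w) ->
  (forall m n w, phi (m + n)%N w <= phi m (iter n T w) + phi n w) ->
  (0 < N)%N -> N%:R^-1 * Rintegral mu [set: Omega] (phi N) < e ->
  {ae mu, forall w, exists M : R, forall n, phi n w <= e * n%:R + M}.
Proof.
move=> ergT mphi phiB phiS phiD N0 Ne.
have NR : 0 < N%:R :> R by rewrite ltr0n.
have {}Ne : Rintegral mu [set: Omega] (phi N) < e * N%:R.
  by rewrite mulrC ltr_pdivrMr// in Ne.
have := birkhoff_sum_le_linear ergT (mphi N) (phiB N) Ne.
apply: filterS => w [M hM].
pose Psi n := \sum_(r < N) phi (n + r)%N w.
have PsiE n : Psi n <= Psi 0%N + birkhoff_sum T (phi N) n w.
  elim: n => [|n ihn]; first by rewrite /birkhoff_sum big_ord0 addr0.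
  have -> : birkhoff_sum T (phi N) n.+1 w = birkhoff_sum T (phi N) n w + phi N (iter n T w).
    by rewrite /birkhoff_sum big_ord_recr.
  have shift : Psi n + phi (N + n)%N w = phi n w + Psi n.+1.
    transitivity (\sum_(r < N.+1) phi (n + r)%N w).
      by rewrite big_ord_recr/= [(n + N)%N]addnC.
    rewrite big_ord_recl addn0; congr (_ + _).
    by apply: eq_bigr => i _; rewrite lift0 addnS addSn.
  have := phiD N n w; move: ihn shift; lra.
have phiPsi n : N%:R * phi n w <= Psi n + N%:R * (c * N%:R).
  have -> : N%:R * phi n w = \sum_(r < N) phi n w.
    by rewrite sumr_const card_ord mulr_natl.
  have -> : N%:R * (c * N%:R) = \sum_(r < N) (c * N%:R).
    by rewrite sumr_const card_ord mulr_natl.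
  rewrite /Psi -big_split/=; apply: ler_sum => r _.
  have c0 : 0 <= c.
    by have := phiB 1%N w; rewrite mulr1; apply: le_trans.
  apply: (@le_trans _ _ (phi (n + r)%N w + c * r%:R)); last first.
    by rewrite lerD2l ler_wpM2l// ler_nat ltnW.
  elim: (nat_of_ord r) => [|k ihk]; first by rewrite addn0 mulr0 addr0.
  by have := phiS (n + k)%N w; rewrite addnS; move: ihk; rewrite -natr1; lra.
exists ((Psi 0%N + M + N%:R * (c * N%:R)) / N%:R) => n.
rewrite -(ler_pM2l NR) mulrDr (mulrCA _ _ N%:R^-1) mulfV ?gt_eqF// mulr1.
have := PsiE n; have := phiPsi n; have := hM n; lra.
Qed.

End SubadditiveBound.

(** * Transfer matrices at real energies *)

Section StepBounds.
Context {R : realType}.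
Implicit Types (u v x y U V : R).

(** A constant bounding both the matrix with rows [(u, -v)] and [(1, 0)] and its
    inverse, when [U] bounds [u] and [V] bounds [v] and its inverse. *)
Definition step_const U V : R := 1 + 2 * U ^+ 2 * (1 + V ^+ 2) + 2 * V ^+ 2.

Lemma step_const_ge1 U V : 1 <= step_const U V.
Proof.
rewrite /step_const -addrA lerDl.
apply: addr_ge0; last by apply: mulr_ge0; rewrite ?sqr_ge0.
apply: mulr_ge0; first by apply: mulr_ge0; rewrite ?sqr_ge0.
by apply: addr_ge0; rewrite ?sqr_ge0.
Qed.

Lemma sqr_le_norm u U : `|u| <= U -> u ^+ 2 <= U ^+ 2.
Proof.
move=> uU; rewrite -[u ^+ 2]real_normK ?num_real//.
by rewrite ler_pXn2r ?nnegrE// (le_trans _ uU).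
Qed.

Lemma step_expansion u v x y U V : `|u| <= U -> `|v| <= V -> 
  (u * x - v * y) ^+ 2 + x ^+ 2 <= step_const U V ^+ 2 * (x ^+ 2 + y ^+ 2).
Proof.
move=> uU vV; set C := step_const U V.
have u2 := sqr_le_norm uU.
have v2 := sqr_le_norm vV.
have h1 : (u * x - v * y) ^+ 2 <= 2 * u ^+ 2 * x ^+ 2 + 2 * v ^+ 2 * y ^+ 2.
  rewrite -subr_ge0.
  have -> : 2 * u ^+ 2 * x ^+ 2 + 2 * v ^+ 2 * y ^+ 2 - (u * x - v * y) ^+ 2
     = (u * x + v * y) ^+ 2 by ring.
  exact: sqr_ge0.
have x2 := sqr_ge0 x; have y2 := sqr_ge0 y.
have h2 := ler_wpM2r x2 u2; have h3 := ler_wpM2r y2 v2.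
have U2 := sqr_ge0 U; have V2 := sqr_ge0 V.
have UV : 0 <= U ^+ 2 * V ^+ 2 by rewrite mulr_ge0.
have C1 : 1 <= C := step_const_ge1 U V.
have CC : C <= C ^+ 2 by rewrite expr2 ler_peMl// (le_trans _ C1).
have h4 := ler_wpM2r (addr_ge0 x2 y2) CC.
apply: le_trans h4; rewrite /C /step_const.
have := mulr_ge0 UV x2; have := mulr_ge0 UV y2.
have := mulr_ge0 U2 y2; have := mulr_ge0 V2 x2.
move: h1 h2 h3.
set s := (_ - _) ^+ 2; lra.
Qed.

(** The second coordinate is recovered from the image by
    [y = (u x - (u x - v y)) / v]. *)
Lemma step_contraction u v x y U V : v != 0 ->
  `|u| <= U -> `|v^-1| <= V ->
  x ^+ 2 + y ^+ 2 <= step_const U V ^+ 2 * ((u * x - v * y) ^+ 2 + x ^+ 2).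
Proof.
move=> v0 uU vV; set C := step_const U V.
set t := u * x - v * y.
have -> : y ^+ 2 = (v^-1 * (u * x - t)) ^+ 2.
  by congr (_ ^+ 2); rewrite /t; field.
move: t => t.
have u2 := sqr_le_norm uU.
have v2 := sqr_le_norm vV.
rewrite [(v^-1 * _) ^+ 2]exprMn.
have h1 : (u * x - t) ^+ 2 <= 2 * u ^+ 2 * x ^+ 2 + 2 * t ^+ 2.
  rewrite -subr_ge0.
  have -> : 2 * u ^+ 2 * x ^+ 2 + 2 * t ^+ 2 - (u * x - t) ^+ 2
     = (u * x + t) ^+ 2 by ring.
  exact: sqr_ge0.
have x2 := sqr_ge0 x; have t2 := sqr_ge0 t.
have h2 := ler_wpM2r x2 u2.
have h3 : v^-1 ^+ 2 * (u * x - t) ^+ 2 <= V ^+ 2 * (2 * U ^+ 2 * x ^+ 2 + 2 * t ^+ 2).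
  apply: ler_pM; [exact: sqr_ge0|exact: sqr_ge0|exact: v2|].
  by move: h1 h2; set s := (_ - _) ^+ 2; lra.
have U2 := sqr_ge0 U; have V2 := sqr_ge0 V.
have UV : 0 <= U ^+ 2 * V ^+ 2 by rewrite mulr_ge0.
have C1 : 1 <= C := step_const_ge1 U V.
have CC : C <= C ^+ 2 by rewrite expr2 ler_peMl// (le_trans _ C1).
have h4 := ler_wpM2r (addr_ge0 t2 x2) CC.
apply: le_trans h4; rewrite /C /step_const.
have := mulr_ge0 UV x2; have := mulr_ge0 UV t2.
have := mulr_ge0 U2 x2; have := mulr_ge0 V2 x2; have := mulr_ge0 U2 t2.
move: h3; set s := v^-1 ^+ 2 * _; lra.
Qed.

End StepBounds.

Section RealCocycle.
Context {R : realType} {d : measure_display} {Omega : measurableType d}.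
Variables (mu : probability Omega R) (T : Omega -> Omega) (f g : Omega -> R).

Definition real_transfer (E : R) (w : Omega) : 'M[R]_2 :=
  \matrix_(i < 2, j < 2)
    if i == ord0 then
      if j == ord0 then (E - g (T w)) / f (T w) else - (f w / f (T w))
    else if j == ord0 then 1 else 0.

Fixpoint real_cocycle (E : R) (n : nat) (w : Omega) : 'M[R]_2 :=
  if n is m.+1 then real_transfer E (iter m T w) *m real_cocycle E m w else 1%:M.

Lemma real_cocycleD E m n w :
  real_cocycle E (m + n)%N w = real_cocycle E m (iter n T w) *m real_cocycle E n w.
Proof.
elim: m => [|m ih]; first by rewrite add0n mul1mx.
by rewrite addSn /= ih mulmxA iterD.
Qed.

Hypothesis f_pos : forall w, 0 < f w.

Lemma transfer_real E w :
  transfer T f g E%:C w = map_mx (real_complex R) (real_transfer E w).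
Proof.
have f0 : f (T w) != 0 by rewrite gt_eqF.
apply/matrixP => i j; rewrite /transfer !mxE.
case: i => [[|[|//]] ?]; case: j => [[|[|//]] ?] /=.
- by rewrite -rmorphB -rmorphM mulrC.
- by rewrite -rmorphN -rmorphM mulrN mulrC.
- by rewrite -rmorphM mulVf.
- by rewrite mulr0 rmorph0.
Qed.

Lemma cocycle_real E n w :
  cocycle T f g E%:C n w = map_mx (real_complex R) (real_cocycle E n w).
Proof.
elim: n => [|n ih] /=; first by rewrite map_mx1.
by rewrite ih transfer_real map_mxM.
Qed.

Definition log_norm E n w : R := ln (real_op_norm (real_cocycle E n w)).

Lemma lyapunov_real E : lyapunov mu T f g E%:C =
  inf [set n%:R^-1 * Rintegral mu [set: Omega] (log_norm E n)
      | n in [set n | (0 < n)%N]].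
Proof.
have H n : (fun w => ln (op_norm (cocycle T f g E%:C n w))) = log_norm E n.
  by apply/funext => w; rewrite cocycle_real.
rewrite /lyapunov.
apply: (congr1 inf).
apply/seteqP; split => _ [n n0 <-]; (exists n; first exact: n0).
  by rewrite -H.
by rewrite -H.
Qed.

Section Bounds.
Variable B : R.
Hypotheses (f_le : forall w, f w <= B) (f_inv_le : forall w, (f w)^-1 <= B)
  (g_le : forall w, `|g w| <= B).

Definition step_bound : R := step_const (2 * B ^+ 2) (B ^+ 2).

Lemma step_bound_gt0 : 0 < step_bound.
Proof. exact: lt_le_trans (step_const_ge1 _ _). Qed.

Lemma sqnorm_image_real_transfer E w x y : sqnorm_image (real_transfer E w) x y =
  ((E - g (T w)) / f (T w) * x - f w / f (T w) * y) ^+ 2 + x ^+ 2.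
Proof. by rewrite /sqnorm_image !mxE/= mul1r mul0r addr0 mulNr. Qed.


Lemma transfer_entry1 E w : `|E| <= B -> `|(E - g (T w)) / f (T w)| <= 2 * B ^+ 2.
Proof.
move=> EB; rewrite normrM normfV (gtr0_norm (f_pos _)) expr2 mulrA.
apply: ler_pM => //; first by rewrite invr_ge0 ltW.
by rewrite (le_trans (ler_normB _ _))// mulr_natl mulr2n lerD.
Qed.

Lemma transfer_entry2 w : `|f w / f (T w)| <= B ^+ 2.
Proof.
rewrite gtr0_norm ?divr_gt0// expr2.
by apply: ler_pM => //; rewrite ?invr_ge0 ltW.
Qed.

Lemma transfer_entry2V w : `|(f w / f (T w))^-1| <= B ^+ 2.
Proof.
rewrite invf_div gtr0_norm ?divr_gt0// expr2.
by apply: ler_pM => //; rewrite ?invr_ge0 ltW.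
Qed.

Lemma real_op_norm_cocycleS_le E n w : `|E| <= B ->
  real_op_norm (real_cocycle E n.+1 w) <= step_bound * real_op_norm (real_cocycle E n w).
Proof.
move=> EB; apply: real_op_norm_comparison => [|x y].
  exact: ltW step_bound_gt0.
rewrite /= sqnorm_imageM sqnorm_image_real_transfer.
by apply: step_expansion; [exact: transfer_entry1|exact: transfer_entry2].
Qed.

(** Together with the upper bound, this keeps the logarithms of the norms within
    linear bounds and prevents them from dropping by more than a constant in one
    step. *)
Lemma real_op_norm_cocycleS_ge E n w : `|E| <= B ->
  real_op_norm (real_cocycle E n w) <= step_bound * real_op_norm (real_cocycle E n.+1 w).
Proof.
move=> EB; apply: real_op_norm_comparison => [|x y].
  exact: ltW step_bound_gt0.
rewrite /= sqnorm_imageM sqnorm_image_real_transfer.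
apply: step_contraction; [|exact: transfer_entry1|exact: transfer_entry2V].
by rewrite mulf_neq0// ?invr_eq0 gt_eqF.
Qed.

Lemma real_op_norm_cocycle_gt0 E n w : `|E| <= B -> 0 < real_op_norm (real_cocycle E n w).
Proof.
move=> EB; elim: n => [|n ih]; first by rewrite real_op_norm1.
by rewrite -(pmulr_rgt0 _ step_bound_gt0) (lt_le_trans ih)// real_op_norm_cocycleS_ge.
Qed.

Lemma log_normS_le E n w : `|E| <= B ->
  log_norm E n.+1 w <= ln step_bound + log_norm E n w.
Proof.
move=> EB; rewrite /log_norm -lnM ?posrE ?real_op_norm_cocycle_gt0 ?step_bound_gt0//.
rewrite ler_ln ?posrE ?mulr_gt0 ?real_op_norm_cocycle_gt0 ?step_bound_gt0//.
exact: real_op_norm_cocycleS_le.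
Qed.

Lemma log_normS_ge E n w : `|E| <= B ->
  log_norm E n w <= ln step_bound + log_norm E n.+1 w.
Proof.
move=> EB; rewrite /log_norm -lnM ?posrE ?real_op_norm_cocycle_gt0 ?step_bound_gt0//.
rewrite ler_ln ?posrE ?mulr_gt0 ?real_op_norm_cocycle_gt0 ?step_bound_gt0//.
exact: real_op_norm_cocycleS_ge.
Qed.

Lemma log_normD E m n w : `|E| <= B ->
  log_norm E (m + n)%N w <= log_norm E m (iter n T w) + log_norm E n w.
Proof.
move=> EB; rewrite /log_norm -lnM ?posrE ?real_op_norm_cocycle_gt0//.
rewrite ler_ln ?posrE ?mulr_gt0 ?real_op_norm_cocycle_gt0//.
by rewrite real_cocycleD real_op_normM.
Qed.

Lemma log_norm_bound E n w : `|E| <= B ->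
  `|log_norm E n w| <= ln step_bound * n%:R.
Proof.
move=> EB; elim: n => [|n ih]; first by rewrite /log_norm real_op_norm1 ln1 normr0 mulr0.
have := log_normS_le n w EB; have := log_normS_ge n w EB.
move: ih.
rewrite -(natr1 n).
move: (log_norm E n w) (log_norm E n.+1 w) (ln step_bound) n%:R => a b c x.
by rewrite !ler_norml; lra.
Qed.

Hypotheses (mT : measurable_fun [set: Omega] T)
  (f_meas : measurable_fun [set: Omega] f)
  (g_meas : measurable_fun [set: Omega] g).

(** Joint measurability in the point and the energy is what Fubini's theorem
    needs. *)
Lemma measurable_real_cocycle n i j :
  measurable_fun [set: Omega * measurableTypeR R]
    (fun p => real_cocycle p.2 n p.1 i j).
Proof.
elim: n i j => [|n ih] i j.
  by under eq_fun do rewrite mxE; exact: measurable_cst.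
under eq_fun do rewrite mxE.
apply: measurable_sum => k; apply: measurable_funM; last exact: ih.
have mTn : measurable_fun [set: Omega * measurableTypeR R] (fun p => iter n T p.1).
  by apply: measurableT_comp; first exact: measurable_iter.
have mTTn := measurableT_comp mT mTn.
have mfV : measurable_fun [set: Omega * measurableTypeR R]
    (fun p => (f (T (iter n T p.1)))^-1).
  have -> : (fun p : Omega * measurableTypeR R => (f (T (iter n T p.1)))^-1) =
      (fun p => expR (- ln (f (T (iter n T p.1))))).
    by apply/funext => p; rewrite expRN lnK// posrE.
  apply: measurableT_comp; first exact: measurable_expR.
  apply: measurable_funN; apply: measurableT_comp; first exact: measurable_ln.
  exact: (measurableT_comp f_meas mTTn).
under eq_fun do rewrite mxE.
case: (i == ord0); case: (k == ord0) => /=.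
- apply: measurable_funM => //; apply: measurable_funB.
    exact: measurable_snd.
  exact: (measurableT_comp g_meas mTTn).
- apply: measurable_funN; apply: measurable_funM => //.
  exact: (measurableT_comp f_meas mTn).
- exact: measurable_cst.
- exact: measurable_cst.
Qed.

Lemma measurable_log_norm E n : measurable_fun [set: Omega] (log_norm E n).
Proof.
apply: measurableT_comp; first exact: measurable_ln.
apply: measurable_real_op_norm => i j.
have mE : measurable_fun [set: Omega]
    (fun w => (w, E) : Omega * measurableTypeR R).
  exact: measurable_fun_pair.
exact: (measurableT_comp (measurable_real_cocycle n i j) mE).
Qed.

End Bounds.
End RealCocycle.

(** * Characteristic polynomials and geometric means *)

Section CharacteristicPolynomial.
Context {R : realType} {d : measure_display} {Omega : measurableType d}.
Variables (T : Omega -> Omega) (f g : Omega -> R).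

(** The orthogonal polynomial of degree [n] together with the previous one; they
    satisfy the three-term recursion normalised to be monic, whence the square of
    the off-diagonal coefficient. *)
Fixpoint jacobi_poly_pair (w : Omega) (n : nat) : {poly R} * {poly R} :=
  if n is m.+1 then
    let: (p, q) := jacobi_poly_pair w m in
    (('X - (g (T (iter m T w)))%:P) * p - (f (iter m T w) ^+ 2) *: q, p)
  else (1, 0).

Definition jacobi_poly w n := (jacobi_poly_pair w n).1.

Lemma jacobi_poly_pair_monic w n : let: (p, q) := jacobi_poly_pair w n in
  [/\ p \is monic, size p = n.+1 & (size q <= n)%N].
Proof.
elim: n => [|n] /=; first by rewrite monic1 size_poly1 size_poly0.
case: (jacobi_poly_pair w n) => p q [pm sp sq].
set A := ('X - _) * p.
have Xm : A \is monic.
  by rewrite monicMl// monicXsubC.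
have sX : size A = n.+2.
  by rewrite size_Mmonic ?polyXsubC_eq0// size_XsubC sp.
have sN : (size (- (f (iter n T w) ^+ 2 *: q)) < size A)%N.
  by rewrite size_polyN sX (leq_ltn_trans (size_scale_leq _ _))// (leq_ltn_trans sq)// ltnW.
split; [by rewrite monicE lead_coefDl// -monicE|by rewrite size_polyDl|by rewrite sp].
Qed.

Lemma jacobi_poly_monic w n : jacobi_poly w n \is monic.
Proof.
have := jacobi_poly_pair_monic w n; rewrite /jacobi_poly.
by case: (jacobi_poly_pair w n) => p q [].
Qed.

Lemma size_jacobi_poly w n : size (jacobi_poly w n) = n.+1.
Proof.
have := jacobi_poly_pair_monic w n; rewrite /jacobi_poly.
by case: (jacobi_poly_pair w n) => p q [].
Qed.

Definition coef_a_prod w n : R := \prod_(1 <= i < n.+1) coef_a T f w i.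

Lemma coef_a_prodS w n : coef_a_prod w n.+1 = coef_a_prod w n * f (T (iter n T w)).
Proof. by rewrite /coef_a_prod big_nat_recr. Qed.

Hypothesis f_pos : forall w, 0 < f w.

Lemma coef_a_prod_gt0 w n : 0 < coef_a_prod w n.
Proof.
elim: n => [|n ih]; first by rewrite /coef_a_prod big_geq.
by rewrite coef_a_prodS mulr_gt0.
Qed.

(** The product starts with [a_1 = f (T w)], hence the composition with [T]. *)
Lemma coef_a_prodE w n :
  coef_a_prod w n = expR (birkhoff_sum T ((@ln R) \o f \o T) n w).
Proof.
elim: n => [|n ih].
  by rewrite /coef_a_prod big_geq// /birkhoff_sum big_ord0 expR0.
rewrite coef_a_prodS /birkhoff_sum big_ord_recr/= expRD -ih.
by rewrite lnK// posrE.
Qed.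

Lemma real_cocycle_jacobi_poly E w n :
  real_cocycle T f g E n w ord0 ord0 * coef_a_prod w n = (jacobi_poly w n).[E].
Proof.
suff : real_cocycle T f g E n w ord0 ord0 * coef_a_prod w n = (jacobi_poly w n).[E] /\
    real_cocycle T f g E n w ord_max ord0 * coef_a_prod w n =
    f (iter n T w) * (jacobi_poly_pair w n).2.[E] by case.
rewrite /jacobi_poly; elim: n => [|n].
  by rewrite /= !mxE/= hornerC horner0 mulr0 mul0r /coef_a_prod big_geq// mulr1.
have f0 : f (T (iter n T w)) != 0 by rewrite gt_eqF.
rewrite /=; case: (jacobi_poly_pair w n) => p q /= [ih1 ih2].
rewrite !mxE !big_ord_recl !big_ord0 !mxE/=.
have -> : lift ord0 ord0 = ord_max :> 'I_2 by exact: val_inj.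
rewrite coef_a_prodS; split.
  rewrite hornerD hornerN hornerZ hornerM hornerXsubC -ih1 expr2 -[f _ * f _ * _]mulrA -ih2.
  by field.
by rewrite mul1r mul0r !addr0 -ih1; ring.
Qed.

End CharacteristicPolynomial.

Section GeometricMean.
Context {R : realType} {d : measure_display} {Omega : measurableType d}.
Variables (mu : probability Omega R) (T : Omega -> Omega) (f : Omega -> R) (B : R).
Hypotheses (T_ergodic : ergodic mu T)
  (f_meas : measurable_fun [set: Omega] f)
  (f_pos : forall w, 0 < f w)
  (f_le : forall w, f w <= B) (f_inv_le : forall w, (f w)^-1 <= B).

(** The logarithm of the almost sure limit of the geometric means. *)
Definition log_mean : R := Rintegral mu [set: Omega] ((@ln R) \o f \o T).

Let h := (@ln R) \o f \o T.

Let B_gt0 : forall w : Omega, 0 < B.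
Proof. by move=> w; exact: lt_le_trans (f_le w). Qed.

Lemma log_coef_bound w : `|h w| <= ln B.
Proof.
rewrite ler_norml; apply/andP; split; last by rewrite ler_ln ?posrE ?B_gt0.
by rewrite lerNl -lnV ?posrE// ler_ln ?posrE ?invr_gt0 ?B_gt0.
Qed.

Lemma measurable_log_coef : measurable_fun [set: Omega] h.
Proof.
have [[mT _] _] := T_ergodic.
apply: (measurableT_comp _ mT); apply: (measurableT_comp _ f_meas).
exact: measurable_ln.
Qed.

Lemma log_coef_sum_le (e : R) : 0 < e -> {ae mu, forall w, exists M : R,
  forall n, birkhoff_sum T h n w <= (log_mean + e) * n%:R + M}.
Proof.
move=> e0; apply: (birkhoff_sum_le_linear T_ergodic measurable_log_coef log_coef_bound).
by rewrite ltrDl.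
Qed.

Lemma log_coef_sum_ge (e : R) : 0 < e -> {ae mu, forall w, exists M : R,
  forall n, (log_mean - e) * n%:R - M <= birkhoff_sum T h n w}.
Proof.
move=> e0.
have mN : measurable_fun [set: Omega] (fun w => - h w).
  by apply: measurable_funN; exact: measurable_log_coef.
have NB w : `|- h w| <= ln B by rewrite normrN log_coef_bound.
have iN : Rintegral mu [set: Omega] (fun w => - h w) < - (log_mean - e).
  under eq_Rintegral do rewrite -mulN1r.
  rewrite RintegralZl//; last first.
    by apply: bounded_integrable; [exact: measurable_log_coef|exact: log_coef_bound].
  by rewrite mulN1r opprB ltrDr.
have := birkhoff_sum_le_linear T_ergodic mN NB iN.
apply: filterS => w [M hM]; exists M => n.
have := hM n; rewrite /birkhoff_sum sumrN mulNr; lra.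
Qed.

Lemma geometric_means_cvg :
  {ae mu, forall w, geometric_means T f w @ \oo --> expR log_mean}.
Proof.
have /ae_foralln hle : forall k : nat, {ae mu, forall w, exists M : R,
  forall n, birkhoff_sum T h n w <= (log_mean + k.+1%:R^-1) * n%:R + M}.
  by move=> k; apply: log_coef_sum_le; rewrite invr_gt0 ltr0n.
have /ae_foralln hge : forall k : nat, {ae mu, forall w, exists M : R,
  forall n, (log_mean - k.+1%:R^-1) * n%:R - M <= birkhoff_sum T h n w}.
  by move=> k; apply: log_coef_sum_ge; rewrite invr_gt0 ltr0n.
apply: filterS2 hle hge => w hle hge.
have gmE n : geometric_means T f w n = expR (n%:R^-1 * birkhoff_sum T h n w).
  rewrite /geometric_means -/(coef_a_prod T f w n) coef_a_prodE//.
  by rewrite -expRM mulrC.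
under eq_cvg do rewrite gmE.
apply: continuous_cvg; first exact: continuous_expR.
apply/cvgrPdist_le => e e0.
have [k ke] : exists k : nat, k.+1%:R^-1 <= e / 2.
  have e2 : 0 < e / 2 by rewrite divr_gt0.
  exists (Num.bound (e / 2)^-1); rewrite -[leRHS]invrK lef_pV2 ?posrE ?invr_gt0//.
  rewrite (le_trans (ltW (archi_boundP _))) ?invr_ge0 ?(ltW e2)//.
  by rewrite ler_nat.
have [M1 hM1] := hle k; have [M2 hM2] := hge k.
have [N hN] : exists N : nat, (`|M1| + `|M2|) / (e / 2) <= N%:R.
  exists (Num.bound ((`|M1| + `|M2|) / (e / 2))); apply/ltW/archi_boundP.
  by apply: divr_ge0; [exact: addr_ge0|rewrite divr_ge0// ltW].
exists N.+1 => // n /= Nn.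
have n0 : 0 < n%:R :> R by rewrite ltr0n (leq_trans _ Nn).
have {}hN : `|M1| + `|M2| <= e / 2 * n%:R.
  rewrite mulrC -ler_pdivrMr ?divr_gt0// (le_trans hN)// ler_nat ltnW//.
have h3 := ler_wpM2r (ltW n0) ke.
have h1 := hM1 n; have h2 := hM2 n.
have a1 := ler_norm M1; have a2 := ler_norm M2.
have a3 := normr_ge0 M1; have a4 := normr_ge0 M2.
rewrite ler_distlC mulrC ler_pdivlMr// ler_pdivrMr//.
move: (n%:R) (k.+1%:R^-1) (birkhoff_sum _ _ _ _) h1 h2 h3 hN => x t S h1 h2 h3 h4.
by apply/andP; split; lra.
Qed.

End GeometricMean.

(** * Measure of a set of energies with small Lyapunov exponent *)

Section FubiniNullSets.
Context {R : realType} {d : measure_display} {Omega : measurableType d}.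
Variable mu : probability Omega R.
Local Notation leb := (@lebesgue_measure R).

(** Both iterated integrals of the indicator function vanish. *)
Lemma null_xsection_ae (A : set (Omega * measurableTypeR R)) :
  measurable A -> (forall E, mu (ysection A E) = 0%E) ->
  {ae mu, forall w, leb (xsection A w) = 0%E}.
Proof.
move=> mA A0.
have mF := indic_measurable_fun_fubini_tonelli_F leb mA.
have := indic_fubini_tonelli mu leb mA.
rewrite indic_fubini_tonelli_GE// [RHS]integral0_eq; last first.
  by move=> E _; exact: A0.
rewrite indic_fubini_tonelli_FE// in mF *.
move=> H.
have /(ae_eq_integral_abs mu measurableT mF) : (\int[mu]_w `|(leb \o xsection A) w| = 0)%E.
  by rewrite -[RHS]H; apply: eq_integral => w _; rewrite gee0_abs.
by apply: filterS => w /(_ I).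
Qed.

Lemma ae_exists (P : Omega -> Prop) : {ae mu, forall w, P w} -> exists w, P w.
Proof.
move=> [N [mN N0 PN]]; apply: contrapT => /forallNP nP.
have : N = setT by apply/seteqP; split => // w _; apply: PN => /=; exact: nP.
move=> NT; move: N0; rewrite NT.
by move=> /(etrans (esym (probability_setT mu)))/eqP; rewrite onee_eq0.
Qed.

End FubiniNullSets.

Section LinearGrowth.
Context {R : realType}.
Implicit Types a b c x : R.

Lemma le_of_linear_growth a b c :
  (forall n, (0 < n)%N -> a * n%:R <= b * n%:R + c) -> a <= b.
Proof.
move=> H; rewrite leNgt; apply/negP => ba.
have ab0 : 0 < a - b by rewrite subr_gt0.
pose n := (Num.bound (`|c| / (a - b))).+1.
have : `|c| / (a - b) < n%:R.
  rewrite (lt_le_trans (archi_boundP _)) ?divr_ge0 ?(ltW ab0)//.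
  by rewrite ler_nat.
rewrite ltr_pdivrMr// mulrC mulrBl => h.
by have := H n isT; have := ler_norm c; lra.
Qed.

Lemma le_expR_of_exp_growth x b c :
  (forall n, (0 < n)%N -> x ^+ n <= expR (b * n%:R + c)) -> x <= expR b.
Proof.
move=> H; have [x0|x0] := leP x 0; first exact: le_trans (expR_ge0 b).
rewrite -(lnK (_ : x \is Num.pos)) ?posrE// ler_expR.
apply: (@le_of_linear_growth _ _ c) => n n0.
by rewrite -ler_expR expRM_natr lnK ?posrE// H.
Qed.

Lemma le_expR_of_slack x b : (forall e, 0 < e -> x <= expR (b + e)) -> x <= expR b.
Proof.
move=> H; have [x0|x0] := leP x 0; first exact: le_trans (expR_ge0 b).
rewrite -(lnK (_ : x \is Num.pos)) ?posrE// ler_expR.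
apply/ler_addgt0Pr => e e0.
by rewrite -ler_expR lnK ?posrE// H.
Qed.

End LinearGrowth.

Section Main.
Context {R : realType} {d : measure_display} {Omega : measurableType d}.
Variables (mu : probability Omega R) (T : Omega -> Omega) (f g : Omega -> R) (B : R).
Hypotheses (T_ergodic : ergodic mu T)
  (f_meas : measurable_fun [set: Omega] f)
  (g_meas : measurable_fun [set: Omega] g)
  (f_pos : forall w, 0 < f w)
  (f_le : forall w, f w <= B) (f_inv_le : forall w, (f w)^-1 <= B)
  (g_le : forall w, `|g w| <= B).
Local Notation leb := (@lebesgue_measure R).
Local Notation L E := (lyapunov mu T f g E%:C).
Local Notation lam := (ln (step_bound B)).

Let mT : measurable_fun [set: Omega] T := T_ergodic.1.1.

Lemma mean_log_norm_bound E n : `|E| <= B -> (0 < n)%N ->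
  - lam <= n%:R^-1 * Rintegral mu [set: Omega] (log_norm T f g E n) <= lam.
Proof.
move=> EB n0.
have n0R : 0 < n%:R :> R by rewrite ltr0n.
have bd w := log_norm_bound T f_pos f_le f_inv_le g_le n w EB.
have ml := measurable_log_norm f_pos mT f_meas g_meas E n.
rewrite mulrC ler_pdivlMr// ler_pdivrMr// mulNr; apply/andP; split.
  apply: (ge_Rintegral_probability mu ml bd) => w.
  by rewrite lerNl (le_trans (ler_norm _))// normrN.
apply: (le_Rintegral_probability mu ml bd) => w.
by rewrite (le_trans (ler_norm _)).
Qed.

(** Makes the set of absolute exponents over a compact set of energies bounded, so
    that each of them is at most the supremum. *)
Lemma lyapunov_bound E : `|E| <= B -> `|L E| <= lam.
Proof.
move=> EB; rewrite lyapunov_real//; set S := (X in inf X).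
have S1 : S (1%:R^-1 * Rintegral mu [set: Omega] (log_norm T f g E 1%N)).
  by exists 1%N.
have Sl : lbound S (- lam).
  by move=> _ [n n0 <-]; have /andP[] := mean_log_norm_bound EB n0.
rewrite ler_norml; apply/andP; split; first by apply: lb_le_inf => //; eexists; exact: S1.
apply: (@le_trans _ _ (1%:R^-1 * Rintegral mu [set: Omega] (log_norm T f g E 1%N))).
  by apply: ge_inf => //; exists (- lam).
by have /andP[] := mean_log_norm_bound EB (ltn0Sn 0).
Qed.

(** The Lyapunov exponent is an infimum over [N], so some fixed [N] already has a
    mean below [e]. *)
Lemma log_norm_le_lyapunov E e : `|E| <= B -> L E < e ->
  {ae mu, forall w, exists M : R,
    forall n, log_norm T f g E n w <= e * n%:R + M}.
Proof.
move=> EB; rewrite lyapunov_real// => /inf_lt[].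
  by eexists; exists 1%N => //; reflexivity.
move=> _ [N N0 <-] Ne.
apply: (subadditive_le_linear (c := lam) T_ergodic _ _ _ _ N0 Ne).
- by move=> n; exact: measurable_log_norm.
- by move=> n w; exact: log_norm_bound.
- by move=> n w; exact: log_normS_ge.
- by move=> m n w; exact: log_normD.
Qed.

Section CompactSet.
Variables (K : set R) (s : R).
Hypotheses (cK : compact K) (K_le : forall E, K E -> `|E| <= B)
  (L_le : forall E, K E -> L E <= s).

Let entry (p : Omega * measurableTypeR R) n : R :=
  `|real_cocycle T f g p.2 n p.1 ord0 ord0|.

Definition growth_bounded (e : R) (M : nat) : set (Omega * measurableTypeR R) :=
  [set p | forall n, entry p n <= expR ((s + e) * n%:R + M%:R)].

Definition growth_unbounded (e : R) : set (Omega * measurableTypeR R) :=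
  [set p | K p.2] `&` \bigcap_M ~` growth_bounded e M.

Lemma measurable_growth_unbounded e : measurable (growth_unbounded e).
Proof.
have mS : measurable [set p : Omega * measurableTypeR R | K p.2].
  rewrite -[X in measurable X]setTI; apply: measurable_snd => //.
  exact: compact_measurable.
apply: measurableI => //; apply: bigcapT_measurable => M; apply: measurableC.
have -> : growth_bounded e M = \bigcap_n
   ((entry^~ n) @^-1` `]-oo, expR ((s + e) * n%:R + M%:R)]).
  apply/seteqP; split => p /=.
    by move=> H n _ /=; rewrite in_itv/=.
  by move=> H n; have := H n I; rewrite /= in_itv/=.
apply: bigcapT_measurable => n; rewrite -[X in measurable X]setTI.
have me : measurable_fun [set: Omega * measurableTypeR R] (entry^~ n).
  apply: measurableT_comp => //; exact: measurable_real_cocycle.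
exact: me.
Qed.

Lemma growth_unbounded_null e E : 0 < e -> mu (ysection (growth_unbounded e) E) = 0%E.
Proof.
move=> e0.
have mA := measurable_ysection E (measurable_growth_unbounded e).
have [KE|KE] := pselect (K E); last first.
  rewrite (_ : ysection _ _ = set0) ?measure0//.
  by apply/seteqP; split => // w; rewrite /ysection/= inE => -[].
have LE : L E < s + e by rewrite (le_lt_trans (L_le KE))// ltrDl.
apply: measure_negligible => //.
apply: negligibleS (log_norm_le_lyapunov (K_le KE) LE) => w.
rewrite /ysection/= inE => -[_ HM] [M hM].
apply: (HM (Num.bound `|M|) I) => n; rewrite /entry /=.
rewrite (le_trans (entry_le_real_op_norm _))//.
have r0 := real_op_norm_cocycle_gt0 T f_pos f_le f_inv_le g_le n w (K_le KE).
rewrite -[leLHS]lnK ?posrE// ler_expR (le_trans (hM n))// lerD2l.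
by rewrite (le_trans (ler_norm _))// ltW// archi_boundP.
Qed.

(** On this set the polynomial [P_n] is bounded by
    [exp ((s + e) n + M) a_1 ... a_n] for every [n], so the set is compact and
    Polya's inequality applies for each [n]; the constants [M] and [M0] disappear
    in the [n]-th root. *)
Lemma growth_bounded_measure e M w (M0 : R) :
  (forall n, birkhoff_sum T ((@ln R) \o f \o T) n w <=
     (log_mean mu T f + e) * n%:R + M0) ->
  measurable (K `&` xsection (growth_bounded e M) w) /\
  (leb (K `&` xsection (growth_bounded e M) w) <=
    (4 * expR (log_mean mu T f + s + (e + e)))%:E)%E.
Proof.
move=> hM0; set A := K `&` _.
have AE : A = K `&` \bigcap_n [set E | `|(jacobi_poly T f g w n).[E]| <=
    expR ((s + e) * n%:R + M%:R) * coef_a_prod T f w n].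
  apply/seteqP; split => E [KE hE]; split => //.
    move=> n _ /=; rewrite -real_cocycle_jacobi_poly// normrM.
    rewrite (gtr0_norm (coef_a_prod_gt0 _ f_pos _ _)).
    rewrite ler_pM2r ?coef_a_prod_gt0//.
    by move: hE; rewrite /xsection/= inE; apply.
  rewrite /xsection/= inE => n; have := hE n I.
  rewrite /= -real_cocycle_jacobi_poly// normrM.
  rewrite (gtr0_norm (coef_a_prod_gt0 _ f_pos _ _)).
  by rewrite ler_pM2r ?coef_a_prod_gt0.
have cA : compact A.
  rewrite AE; apply: compact_closedI => //; apply: closed_bigI => n _.
  pose F (E : R) : R := `|(jacobi_poly T f g w n).[E]|.
  have cF : continuous F.
    move=> E; apply: (@continuous_comp _ _ _ (horner (jacobi_poly T f g w n))).
      exact: continuous_horner.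
    exact: norm_continuous.
  exact: (closed_comp (fun x _ => cF x) (@closed_le R _)).
split; first exact: compact_measurable.
have fA := compact_finite_measure cA.
rewrite -(fineK (_ : leb A \is a fin_num)) ?ge0_fin_numE// lee_fin.
rewrite -ler_pdivrMl// mulrC.
apply: (@le_expR_of_exp_growth _ _ _ (M%:R + M0)) => n n0.
have := @polya_inequality R A (jacobi_poly T f g w n) n
  (expR ((s + e) * n%:R + M%:R) * coef_a_prod T f w n) n0 cA
  (jacobi_poly_monic _ _ _ _ _) (size_jacobi_poly _ _ _ _ _).
rewrite coef_a_prodE// -expRD => /(_ (expR_ge0 _)) H.
have {}H : 2 * (fine (leb A) / 4) ^+ n <= expR ((s + e) * n%:R + M%:R +
    birkhoff_sum T ((@ln R) \o f \o T) n w).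
  apply: H => E; rewrite AE => -[_ /(_ n I)] /=.
  by rewrite coef_a_prodE// -expRD.
have x0 : 0 <= (fine (leb A) / 4) ^+ n by rewrite exprn_ge0// divr_ge0// fine_ge0.
apply: (@le_trans _ _ (2 * (fine (leb A) / 4) ^+ n)); first by rewrite ler_peMl// ler1n.
apply: (le_trans H); rewrite ler_expR; have := hM0 n; lra.
Qed.

(** One point [w] suffices, since the estimate does not depend on it: take one
    for which the off-diagonal products grow as expected and almost every energy
    of [K] has controlled growth, then let [M] tend to infinity. *)
Lemma measure_le_slack e : 0 < e ->
  (leb K <= (4 * expR (log_mean mu T f + s + (e + e)))%:E)%E.
Proof.
move=> e0.
have h1 := log_coef_sum_le T_ergodic f_meas f_pos f_le f_inv_le e0.
have h2 := null_xsection_ae (measurable_growth_unbounded e)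
  (fun E => growth_unbounded_null E e0).
have [w [[M0 hM0] null]] : exists w,
    (exists M : R, forall n, birkhoff_sum T ((@ln R) \o f \o T) n w <=
       (log_mean mu T f + e) * n%:R + M) /\
    leb (xsection (growth_unbounded e) w) = 0%E.
  by apply: (@ae_exists _ _ _ mu); apply: filterS2 h1 h2.
pose A M := K `&` xsection (growth_bounded e M) w.
have mA M : measurable (A M) by have [] := growth_bounded_measure M hM0.
have leA M : (leb (A M) <= (4 * expR (log_mean mu T f + s + (e + e)))%:E)%E.
  by have [] := growth_bounded_measure M hM0.
have ndA : nondecreasing_seq A.
  move=> m n mn; apply/subsetPset => E [KE]; rewrite /xsection/= !inE => hE.
  split => //; rewrite /xsection/= inE => k; apply: (le_trans (hE k)).
  by rewrite ler_expR lerD2l ler_nat.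
have mU : measurable (\bigcup_M A M) by exact: bigcupT_measurable.
have mX := measurable_xsection w (measurable_growth_unbounded e).
have KA : K `<=` xsection (growth_unbounded e) w `|` \bigcup_M A M.
  move=> E KE; have [[M hM]|hM] := pselect (exists M, growth_bounded e M (w, E)).
    by right; exists M => //; split => //; rewrite /xsection/= inE.
  left; rewrite /xsection/= inE; split => // M _ /= hE; apply: hM; by exists M.
have mK := compact_measurable cK.
apply: (@le_trans _ _ (leb (xsection (growth_unbounded e) w `|` \bigcup_M A M))).
  by apply: le_measure => //; rewrite inE//; exact: measurableU.
have le0 : (leb (xsection (growth_unbounded e) w) <= 0)%E by rewrite null.
apply: (le_trans (measureU2 leb mX mU)).
apply: (le_trans (leeD le0 (lexx _))); rewrite add0e.
have cvA := nondecreasing_cvg_mu (mu := leb) mA mU ndA.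
apply: (@le_trans _ _ (limn (leb \o A))); last first.
  apply: lime_le; first by apply/cvg_ex; eexists; exact: cvA.
  by apply: nearW => M; exact: leA.
rewrite le_eqVlt; apply/orP; left; apply/eqP.
exact: esym (cvg_lim (@ereal_hausdorff R) cvA).
Qed.

Lemma measure_le_lyapunov :
  (leb K <= (4 * expR (log_mean mu T f) * expR s)%:E)%E.
Proof.
have fK := compact_finite_measure cK.
have fnK : leb K \is a fin_num by rewrite ge0_fin_numE.
rewrite -mulrA -expRD -(fineK fnK) lee_fin -ler_pdivrMl// mulrC.
apply: le_expR_of_slack => e e0.
have := @measure_le_slack (e / 2) (divr_gt0 e0 _); rewrite -(fineK fnK) lee_fin.
by rewrite -ler_pdivrMl// mulrC -splitr; apply.
Qed.

End CompactSet.
End Main.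

Theorem theorem3p2 (R : realType) (d : measure_display)
    (Omega : measurableType d) (mu : probability Omega R)
    (T : Omega -> Omega) (f g : Omega -> R) (Sigma : set R)
    (T_ergodic : ergodic mu T)
    (f_meas : measurable_fun [set: Omega] f)
    (g_meas : measurable_fun [set: Omega] g)
    (f_pos : forall w, 0 < f w)
    (f_bounded : bounded_fun f)
    (f_invertible : bounded_fun (fun w => (f w)^-1))
    (g_bounded : bounded_fun g)
    (Sigma_compact : compact Sigma)
    (Sigma_spectrum : {ae mu, forall w,
       spectrum (ergodic_jacobi T f g w) = [set E%:C | E in Sigma]}) :
  {ae mu, forall w,
    cvgn (geometric_means T f w) /\
    (lebesgue_measure Sigma <=
      (4 * limn (geometric_means T f w) *
       expR (sup [set `|lyapunov mu T f g E%:C| | E in Sigma]))%:E)%E}.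
Proof.
have bound (U : Type) (A : set U) (F : U -> R) : [bounded F x | x in A] ->
    exists2 M, 0 <= M & forall x, A x -> `|F x| <= M.
  move=> [M [_ FM]]; exists (`|M| + 1) => [|x]; first exact: addr_ge0.
  by apply: FM; rewrite (le_lt_trans (ler_norm M))// ltrDl.
have [Mf Mf0 fM] := bound _ _ _ f_bounded.
have [Mv Mv0 vM] := bound _ _ _ f_invertible.
have [Mg Mg0 gM] := bound _ _ _ g_bounded.
have [MK MK0 KM] := bound _ _ id (compact_bounded Sigma_compact).
pose B := Mf + Mv + Mg + MK.
have f_le w : f w <= B.
  by have := fM w I; have := ler_norm (f w); rewrite /B; lra.
have f_inv_le w : (f w)^-1 <= B.
  by have := vM w I; have := ler_norm (f w)^-1; rewrite /B; lra.
have g_le w : `|g w| <= B by have := gM w I; rewrite /B; lra.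
have Sigma_le E : Sigma E -> `|E| <= B.
  by move=> SE; have := KM E SE; rewrite /= /B; lra.
have Lsup E : Sigma E -> lyapunov mu T f g E%:C <=
    sup [set `|lyapunov mu T f g E%:C| | E in Sigma].
  move=> SE; rewrite (le_trans (ler_norm _))//; apply: ub_le_sup; last by exists E.
  exists (ln (step_bound B)) => _ [E' SE' <-].
  exact: (lyapunov_bound T_ergodic f_meas g_meas f_pos f_le f_inv_le g_le (Sigma_le _ SE')).
have := geometric_means_cvg T_ergodic f_meas f_pos f_le f_inv_le.
apply: filterS => w cvA; split; first by apply/cvg_ex; eexists; exact: cvA.
rewrite (cvg_lim _ cvA)//.
exact: (measure_le_lyapunov T_ergodic f_meas g_meas f_pos f_le f_inv_le g_le
  Sigma_compact Sigma_le Lsup).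
Qed.
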